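(* Let $S$ and $S'$ be triangulated surfaces, with sets of triangles $T$ and $T'$ respectively. Suppose there is a bijection $f\colon T\to T'$ such that for any two triangles $t_1,t_2\in T$ one has $|t_1\cap t_2| = |f(t_1)\cap f(t_2)|$. Then $S$ and $S'$ are isomorphic as simplicial complexes.
   Context: A triangulated surface is a simplicial complex whose underlying topological space is a connected $2$-manifold without boundary (a closed connected surface). Triangles are identified with their $3$-element vertex sets, and $|t_1\cap t_2|$ denotes the number of common vertices of $t_1$ and $t_2$. Two triangulated surfaces satisfying the hypothesis are said to have the same intersection matrix. *)

(* Defs.v *)
From HB Require Import structures.
From mathcomp Require Import all_boot all_order all_algebra.
From mathcomp Require Import all_classical all_reals all_analysis.

Set Implicit Arguments.
Unset Strict Implicit.
Unset Printing Implicit Defensive.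

Import Order.TTheory GRing.Theory Num.Theory.
Import numFieldNormedType.Exports.

Local Open Scope classical_set_scope.
Local Open Scope ring_scope.

Definition homeomorphic (X Y : topologicalType) : Prop :=
  exists (f : X -> Y) (g : Y -> X),
    [/\ continuous f, continuous g, cancel f g & cancel g f].

(* The sets U and W are coerced to the types of their elements, which carry
   the subspace topology. *)
Definition locally_euclidean (R : realType) (n : nat) (X : topologicalType)
    : Prop :=
  forall x : X, exists (U : set X) (W : set 'rV[R]_n),
    [/\ open U, U x, open W & homeomorphic U W].

Definition manifold (R : realType) (n : nat) (X : topologicalType) : Prop :=
  [/\ hausdorff_space X, @second_countable X & locally_euclidean R n X].

(* The library counts the empty set as connected; a connected space is
   nonempty here. *)
Definition closed_connected_surface (R : realType) (X : topologicalType)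
    : Prop :=
  [/\ manifold R 2 X, compact [set: X], connected [set: X]
    & [set: X] !=set0].

(* Finite abstract simplicial complexes whose vertices are all the elements
   of V; the empty set is not counted as a face. *)
Record simplicial_complex (V : finType) := SimplicialComplex {
  faces : {set {set V}};
  faces_neq0 : finset.set0 \notin faces;
  vertex_face : forall v : V, [set v]%SET \in faces;
  faces_sub : forall s t : {set V},
    s \in faces -> t \subset s -> t != finset.set0 -> t \in faces
}.

Definition triangles (V : finType) (K : simplicial_complex V) :
    {set {set V}} :=
  [set t in faces K | #|t| == 3%N]%SET.

(* Barycentric coordinates, with the topology induced by the product topology
   on R^V. *)
Definition realization (R : realType) (V : finType)
    (K : simplicial_complex V) : set {ptws V -> R} :=
  [set x | [/\ forall v : V, 0 <= x v, \sum_(v : V) x v = 1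
             & [set v : V | x v != 0]%SET \in faces K]].
Arguments realization R [V] K.

Definition triangulated_surface (R : realType) (V : finType)
    (K : simplicial_complex V) : Prop :=
  closed_connected_surface R (realization R K).

Definition isomorphic (V V' : finType) (K : simplicial_complex V)
    (K' : simplicial_complex V') : Prop :=
  exists phi : V -> V', bijective phi /\
    forall s : {set V}, (s \in faces K) = ((phi @: s)%SET \in faces K').

(* Main.v *)
Require Import Defs.
From mathcomp Require Import all_boot all_order all_algebra.
From mathcomp Require Import all_classical all_reals all_analysis.
From mathcomp Require Import lra zify.

(* The realization determines the combinatorics through invariance of domain in
   the plane.  Invariance of domain is proved with a discrete winding number: if
   f is injective on a disc of centre p, the loop f(p + c(t)) - f(p) is homotopic
   in the punctured plane to the odd loop f(p + c(t)/2) - f(p - c(t)/2), so that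
   it has odd winding number, and f takes every value near f(p).  It follows that
   all faces have at most three vertices, that every edge lies in exactly two
   triangles and that vertex links are connected.

   A bijection f of the triangles preserving the intersection matrix preserves
   adjacency, hence maps the vertices of each triangle t to those of f(t), a vertex
   being determined by the neighbour of t across the opposite edge.  If these maps
   agree on the common edge of any two adjacent triangles, they glue to an
   isomorphism.  If they are twisted along some edge xy, the intersection numbers
   of the six triangles around that edge force the surface to be one of two
   triangulations of the projective plane, with 6 and 7 vertices; the matrix has
   symmetries not induced by the surface there, but both sides are then the same
   explicit triangulation. *)

Set Implicit Arguments.
Unset Strict Implicit.
Unset Printing Implicit Defensive.

(** * Winding numbers and invariance of domain in the plane *)

(** Winding is counted in quarter turns between half-open quadrants, so that homotopy invariance
    becomes cancellation in a finite sum; compactness supplies a mesh at which neighbouring samples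
    never lie in opposite quadrants. Invariance of domain is used in two directions. Coordinates
    that are injective near a point fill a planar neighbourhood, so too few triangles at an edge
    would leave a half-plane empty. An embedded disc is a neighbourhood in the surface, so a fourth
    vertex of a face or a third triangle on an edge finds no room. Links are connected because a
    point does not separate a disc. Intersections of size 2 give the maps on the vertices of each
    triangle; the difference between sizes 0 and 1 controls twists. If [xy], between [xya] and
    [xyb], is twisted, the edges [xa], [ya], [xb], [yb] decide: a further twist among them gives six
    vertices, none gives seven. Both cases end alike: once the forced triangles cover each of their
    edges twice, connectedness leaves no others. *)

Section DiscreteWinding.
Import Order.TTheory GRing.Theory Num.Theory.
Local Open Scope ring_scope.

(* Quadrants in Gray code: two quadrants are opposite iff both bits differ. *)
Definition opposite (l m : bool * bool) := (l.1 != m.1) && (l.2 != m.2).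

Definition quadrant_rank (l : bool * bool) : int :=
  if l.1 then (if l.2 then 2 else 3) else (if l.2 then 1 else 0).

(** The signed step around the four quadrants; opposite quadrants, between which no direction is
    distinguished, get 0. *)
Definition quarter_turns (l m : bool * bool) : int :=
  let d := quadrant_rank m - quadrant_rank l in
  if (d == 1) || (d == -3) then 1
  else if (d == -1) || (d == 3) then -1 else 0.

Lemma quarter_turns_tri l m n : ~~ opposite l m -> ~~ opposite m n ->
  ~~ opposite l n -> quarter_turns l m + quarter_turns m n = quarter_turns l n.
Proof. by case: l m n => [[] []] [[] []] [[] []]. Qed.

Definition antipode (l : bool * bool) := (~~ l.1, ~~ l.2).

Lemma quarter_turns_antipode l m :
  quarter_turns (antipode l) (antipode m) = quarter_turns l m.
Proof. by case: l m => [[] []] [[] []]. Qed.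

Lemma quarter_turns_mod4 l m : ~~ opposite l m ->
  exists k : int, quarter_turns l m = quadrant_rank m - quadrant_rank l + 4 * k.
Proof.
by case: l m => [[] []] [[] []] // _;
  first [by exists 0 | by exists 1 | by exists (-1)].
Qed.

Definition turning (M : nat) (l : nat -> bool * bool) : int :=
  \sum_(j < M) quarter_turns (l j) (l j.+1).

(** Each cell of the strip between the two loops is cut by its diagonal from [l j] to [m j.+1] into
    two triangles, to which [quarter_turns_tri] applies; hence the condition on diagonals. *)
Lemma turning_homotopy M (l m : nat -> bool * bool) :
  (forall j, (j < M)%N -> [/\ ~~ opposite (l j) (l j.+1),
     ~~ opposite (m j) (m j.+1) & ~~ opposite (l j) (m j.+1)]) ->
  (forall j, (j <= M)%N -> ~~ opposite (l j) (m j)) ->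
  l M = l 0%N -> m M = m 0%N -> turning M l = turning M m.
Proof.
move=> H1 H2 lM mM.
(* For open paths the two end edges of the strip remain as correction terms; they cancel once both
   paths close up. *)
suff : turning M l + quarter_turns (l M) (m M)
     = quarter_turns (l 0%N) (m 0%N) + turning M m by rewrite lM mM; lia.
rewrite /turning; elim: M {lM mM} H1 H2 => [|M IH] H1 H2.
  by rewrite !big_ord0; lia.
rewrite !big_ord_recr /=.
have := IH (fun j h => H1 j (ltnW h)) (fun j h => H2 j (leq_trans h (leqnSn M))).
have [a b c] := H1 M (leqnn _).
have := quarter_turns_tri a (H2 M.+1 (leqnn _)) c.
have := quarter_turns_tri (H2 M (leqnSn _)) b c.
by move: (\sum_(i < M) _) (\sum_(i < M) _) => u v e1 e2; move: e1; rewrite -e2; lia.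
Qed.

Lemma turning_mod4 M (l : nat -> bool * bool) :
  (forall j, (j < M)%N -> ~~ opposite (l j) (l j.+1)) ->
  exists k : int, turning M l = quadrant_rank (l M) - quadrant_rank (l 0%N) + 4 * k.
Proof.
rewrite /turning; elim: M => [|M IH] H.
  by exists 0; rewrite big_ord0; lia.
have [k Hk] := IH (fun j h => H j (ltnW h)).
have [k' Hk'] := quarter_turns_mod4 (H M (leqnn _)).
by exists (k + k'); rewrite big_ord_recr /= Hk Hk'; lia.
Qed.

(** The second half repeats the first, rotated by half a turn. The first half leads from a quadrant
    to its antipode, hence makes 2 modulo 4 quarter turns, and twice such a number is not 0. *)
Lemma turning_odd N (l : nat -> bool * bool) :
  (forall j, (j < N)%N -> ~~ opposite (l j) (l j.+1)) ->
  (forall j, (j <= N)%N -> l (N + j)%N = antipode (l j)) ->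
  turning (N + N) l != 0.
Proof.
move=> H1 H2.
have -> : turning (N + N) l = turning N l + turning N l.
  rewrite {1}/turning big_split_ord /=; congr (_ + _).
  apply: eq_bigr => j _ /=.
  by rewrite -addnS !H2 ?quarter_turns_antipode // ltnW.
have [k ->] := turning_mod4 H1.
have := H2 0%N (leq0n _); rewrite addn0 => ->.
by case: (l 0%N) => [[] []]; rewrite /quadrant_rank /=; lia.
Qed.

Lemma turning_const M l : turning M (fun=> l) = 0.
Proof. by rewrite /turning big1 // => j _; case: l => [[] []]. Qed.

End DiscreteWinding.

(** * Winding of continuous planar loops, sampled on a fine grid *)

Section Winding.
Import Order.TTheory GRing.Theory Num.Theory.
Import numFieldNormedType.Exports.
Local Open Scope classical_set_scope.
Local Open Scope ring_scope.
Variable R : realType.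
Implicit Types (p q P Q : R * R).

Lemma pair_normE p : `|p| = Num.max `|p.1| `|p.2|.
Proof. by rewrite prod_normE. Qed.

(** The quadrants are half open, each with one of its bounding half-axes, so that negation is the
    antipode on the axes as well. *)
Definition quadrant p : bool * bool :=
  ((p.2 < 0) || ((p.2 == 0) && (p.1 < 0)),
   (p.1 < 0) || ((p.1 == 0) && (0 < p.2))).

Lemma quadrantN p : p != 0 -> quadrant (- p) = antipode (quadrant p).
Proof.
case: p => a b; rewrite -pair_eqE /= negb_and /quadrant /antipode /= !oppr_lt0
    !oppr_gt0 !oppr_eq0.
by case: (ltgtP a 0); case: (ltgtP b 0).
Qed.

(** Opposite quadrants have weakly opposite signs in both coordinates, so subtracting [q] shortens
    no coordinate of [p]. *)
Lemma opposite_norm p q : opposite (quadrant p) (quadrant q) -> `|p| <= `|p - q|.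
Proof.
have sgn (a b : R) : a * b <= 0 -> `|a| <= `|a - b|.
  have [a0 ab|a0 ab|-> _] := ltgtP a 0; last by rewrite normr0.
    have b0 : 0 <= b by nra.
    by rewrite ltr0_norm // distrC ger0_norm; lra.
  have b0 : b <= 0 by nra.
  by rewrite gtr0_norm // ger0_norm; lra.
case: p q => [a b] [c d] /andP[/= h1 h2].
rewrite !pair_normE /= ge_max !le_max.
have /sgn -> : a * c <= 0.
  by move: h2; rewrite /quadrant /=; case: (ltgtP a 0) => ha; case: (ltgtP c 0) =>
      hc //= _; nra.
have /sgn -> : b * d <= 0.
  by move: h1; rewrite /quadrant /=; case: (ltgtP b 0) => ha; case: (ltgtP d 0) =>
      hc //= _; nra.
by rewrite orbT.
Qed.

(** The first coordinate is the homotopy parameter, the second the time of a loop of period 2, so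
    that time 1 is half a period. *)
Definition cylinder : set (R * R) := `[0, 1] `*` `[0, 2].

Lemma compact_cylinder : compact cylinder.
Proof. by apply: compact_setX; exact: segment_compact. Qed.

(** Near each point [F] varies by less than a fraction of its norm, which excludes opposite
    quadrants by [opposite_norm]; compactness makes the mesh uniform. *)
Lemma fine_grid (F : R * R -> R * R) :
  (forall P, cylinder P -> {for P, continuous F}) ->
  (forall P, cylinder P -> F P != 0) ->
  \forall n \near \oo, forall P, cylinder P -> forall Q, cylinder Q ->
     `|P - Q| <= n.+1%:R^-1 -> ~~ opposite (quadrant (F P)) (quadrant (F Q)).
Proof.
move=> Fc Fn.
have /compact_near_coveringP H := compact_cylinder.
have := H nat \oo (fun n P => forall Q, cylinder Q ->
     `|P - Q| <= n.+1%:R^-1 -> ~~ opposite (quadrant (F P)) (quadrant (F Q))) _ _.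
apply => x Kx.
(* If [F y] and [F Q] are within a quarter of the norm of [F x] from [F x], they differ by less than
   half that norm, while [F y] keeps more than three quarters of it. *)
have e0 : 0 < `|F x| / 4 by rewrite divr_gt0 ?normr_gt0 ?Fn.
have /nbhs_ballP[d /= d0 dF] : nbhs x [set y | `|F x - F y| < `|F x| / 4].
  by have /cvgr_dist_lt/(_ _ e0) := Fc x Kx.
have d2 : 0 < d / 2 by lra.
exists (ball x (d / 2), [set n | n.+1%:R^-1 < d / 2]).
  split; first exact: nbhsx_ballx.
  by have := near_infty_natSinv_lt (PosNum d2).
move=> [y n] /= [xy nd] Q KQ yQ.
have h1 : `|F x - F y| < `|F x| / 4.
  by apply: dF; apply: le_ball xy; lra.
have h2 : `|F x - F Q| < `|F x| / 4.
  apply: dF; rewrite -ball_normE /=; move: xy; rewrite -ball_normE /= => xy.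
  by rewrite (le_lt_trans (ler_distD y x Q)) // (splitr d) ltrD // (le_lt_trans yQ).
apply/negP => /opposite_norm h3.
have := ler_distD (F x) (F y) (F Q); rewrite (distrC (F y) (F x)).
have := ler_distD (F y) (F x) 0; rewrite !subr0.
by lra.
Qed.

Definition grid_loop n (c : R -> R * R) (j : nat) : bool * bool :=
  quadrant (c (j%:R / n.+1%:R)).

(** Consecutive rows of a fine grid are compared by [turning_homotopy]; in the maximum norm diagonal
    neighbours are as close as adjacent ones, so one mesh bound serves all conditions. *)
Lemma winding_homotopy (F : R * R -> R * R) :
  (forall P, cylinder P -> {for P, continuous F}) ->
  (forall P, cylinder P -> F P != 0) ->
  (forall s, F (s, 0) = F (s, 2)) ->
  \forall n \near \oo,
    turning (n.+1 + n.+1) (grid_loop n (fun t => F (0, t))) =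
    turning (n.+1 + n.+1) (grid_loop n (fun t => F (1, t))).
Proof.
move=> Fc Fn Fp; near=> n.
have H : forall P, cylinder P -> forall Q, cylinder Q ->
     `|P - Q| <= n.+1%:R^-1 -> ~~ opposite (quadrant (F P)) (quadrant (F Q)).
  by near: n; exact: fine_grid.
have n0 : 0 < n.+1%:R :> R by rewrite ltr0n.
have nN : n.+1%:R != 0 :> R by rewrite gt_eqF.
have Kij i j : (i <= n.+1)%N -> (j <= n.+1 + n.+1)%N ->
    cylinder (i%:R / n.+1%:R, j%:R / n.+1%:R).
  move=> hi hj; split; rewrite /= in_itv /= divr_ge0 //= ler_pdivrMr ?ltr0n //.
    by rewrite mul1r ler_nat.
  by rewrite -natrM ler_nat; lia.
have dd i : `|i%:R / n.+1%:R - i.+1%:R / n.+1%:R : R| <= n.+1%:R^-1.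
  by rewrite -mulrBl -natr1 opprD addrA subrr add0r mulN1r normrN ger0_norm // invr_ge0
      ltW.
have K0 i : `|i%:R / n.+1%:R - i%:R / n.+1%:R : R| <= n.+1%:R^-1.
  by rewrite subrr normr0 invr_ge0 ltW.
have two : (n.+1 + n.+1)%:R / n.+1%:R = 2 :> R by rewrite natrD mulrDl divff.
have key i : (i <= n.+1)%N ->
  turning (n.+1 + n.+1) (grid_loop n (fun t => F (0, t))) =
  turning (n.+1 + n.+1) (grid_loop n (fun t => F (i%:R / n.+1%:R, t))).
  elim: i => [_|i IH hi]; first by rewrite mul0r.
  rewrite (IH (ltnW hi)); apply: (@turning_homotopy (n.+1 + n.+1)).
  - move=> j hj; have hj' := ltnW hj; have hi' := ltnW hi.
    by split; apply: (H _ (Kij _ _ _ _) _ (Kij _ _ _ _)) => //;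
      rewrite pair_normE ge_max ?dd ?K0.
  - move=> j hj; have hi' := ltnW hi.
    apply: (H _ (Kij _ _ _ _) _ (Kij _ _ _ _)) => //.
    by rewrite pair_normE ge_max ?dd ?K0.
  - by rewrite /grid_loop two mul0r Fp.
  - by rewrite /grid_loop two mul0r Fp.
by have := key n.+1 (leqnn _); rewrite divff.
Unshelve. all: by end_near.
Qed.

Lemma winding_odd (F : R * R -> R * R) :
  (forall P, cylinder P -> {for P, continuous F}) ->
  (forall P, cylinder P -> F P != 0) ->
  (forall t, F (1, t + 1) = - F (1, t)) ->
  \forall n \near \oo,
    turning (n.+1 + n.+1) (grid_loop n (fun t => F (1, t))) != 0.
Proof.
move=> Fc Fn Fp; near=> n.
have H : forall P, cylinder P -> forall Q, cylinder Q ->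
     `|P - Q| <= n.+1%:R^-1 -> ~~ opposite (quadrant (F P)) (quadrant (F Q)).
  by near: n; exact: fine_grid.
have n0 : 0 < n.+1%:R :> R by rewrite ltr0n.
have nN : n.+1%:R != 0 :> R by rewrite gt_eqF.
have Kj j : (j <= n.+1)%N -> cylinder (1, j%:R / n.+1%:R).
  move=> hj; split; rewrite /= in_itv /= ?ler01 ?lexx //.
  rewrite divr_ge0 //= ler_pdivrMr ?ltr0n //.
  by rewrite -natrM ler_nat; lia.
apply: (@turning_odd n.+1) => j hj; rewrite /grid_loop.
  apply: (H _ (Kj _ (ltnW hj)) _ (Kj _ hj)).
  rewrite pair_normE ge_max /= subrr normr0 invr_ge0 ltW //=.
  by rewrite -mulrBl -natr1 opprD addrA subrr add0r mulN1r normrN ger0_norm // invr_ge0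
      ltW.
rewrite natrD mulrDl divff // addrC Fp quadrantN //.
exact: (Fn _ (Kj _ hj)).
Unshelve. all: by end_near.
Qed.

End Winding.

Arguments cylinder {R} _.

(** * Invariance of domain in the plane *)

Section InvarianceOfDomain.
Import Order.TTheory GRing.Theory Num.Theory.
Import numFieldNormedType.Exports.
Local Open Scope classical_set_scope.
Local Open Scope ring_scope.
Variable R : realType.
Implicit Types (p q P Q : R * R).

(** With the angle [pi * t] and radii of either sign, advancing [t] by 1 amounts to negating [r]. *)
Definition circle_point p (r t : R) : R * R :=
  (p.1 + r * cos (pi * t), p.2 + r * sin (pi * t)).

Lemma pair_continuous (T : topologicalType) (f g : T -> R) x :
  {for x, continuous f} -> {for x, continuous g} ->
  {for x, continuous (fun y => (f y, g y))}.
Proof. by move=> fc gc; exact: (cvg_pair fc gc). Qed.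

Lemma circle_point_continuous p (k : R * R -> R) : continuous k ->
  continuous (fun P => circle_point p (k P) P.2).
Proof.
move=> kc P.
have h : {for P, continuous (fun P : R * R => pi * P.2)}.
  by apply: cvgM; [exact: cvg_cst|exact: cvg_snd].
rewrite /circle_point; apply: (@pair_continuous _ (fun P => p.1 + k P * cos (pi * P.2))
  (fun P => p.2 + k P * sin (pi * P.2))).
  have hc : {for P, continuous (fun P : R * R => cos (pi * P.2))}.
    by apply: (continuous_comp h); exact: continuous_cos.
  by apply: (@cvgD _ R^o _ _ _ (fun=> p.1)); [exact: cvg_cst|apply: cvgM;
      [exact: kc|exact: hc]].
have hs : {for P, continuous (fun P : R * R => sin (pi * P.2))}.
  by apply: (continuous_comp h); exact: continuous_sin.
by apply: (@cvgD _ R^o _ _ _ (fun=> p.2)); [exact: cvg_cst|apply: cvgM;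
    [exact: kc|exact: hs]].
Qed.

Lemma circle_point_inj p r r' t :
  circle_point p r t = circle_point p r' t -> r = r'.
Proof.
case=> /addrI h1 /addrI h2.
have h := cos2Dsin2 (pi * t).
rewrite -[r]mulr1 -[r']mulr1 -h !expr2 !mulrDr !mulrA.
by rewrite h1 h2.
Qed.

Lemma circle_pointD1 p r t : circle_point p r (t + 1) = circle_point p (- r) t.
Proof. by rewrite /circle_point mulrDr mulr1 cosDpi sinDpi !mulrN !mulNr. Qed.

Lemma circle_point_period p r : circle_point p r 0 = circle_point p r 2.
Proof.
have -> : 2 = 0 + 1 + 1 :> R by lra.
by rewrite !circle_pointD1 opprK.
Qed.

Lemma circle_point_ball p e r t : `|r| < e -> ball p e (circle_point p r t).
Proof.
move=> re; rewrite -ball_normE /= pair_normE gt_max /=.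
rewrite !opprD !addrA !subrr !add0r !normrN !normrM.
rewrite !(le_lt_trans _ re) // ler_piMr // ler_norml.
  by rewrite sin_geN1 sin_le1.
by rewrite cos_geN1 cos_le1.
Qed.

Lemma invariance_of_domain (f : R * R -> R * R) (D : set (R * R)) p :
  nbhs p D -> (forall q, D q -> {for q, continuous f}) ->
  {in D &, injective f} -> nbhs (f p) (f @` D).
Proof.
move=> /nbhs_ballP[e /= e0 eD] fc fi.
pose r := e / 2; have r0 : 0 < r by rewrite /r; lra.
have Dc k t : `|k| <= r -> D (circle_point p k t).
  move=> kr; apply: eD; apply: circle_point_ball.
  by rewrite (le_lt_trans kr) // /r; lra.
have fcc (k : R * R -> R) : continuous k -> (forall P, cylinder P -> `|k P| <= r) ->
    forall P, cylinder P -> {for P, continuous (fun P => f (circle_point p (k P) P.2))}.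
  move=> kc kr P KP.
  apply: (@continuous_comp _ _ _ (fun P => circle_point p (k P) P.2) f).
    exact: circle_point_continuous.
  by apply: fc; apply: Dc; exact: kr.
have rn : `|r| <= r by rewrite ger0_norm // ltW.
have fcr P : cylinder P -> {for P, continuous (fun P => f (circle_point p r P.2))}.
  by apply: (fcc (fun=> r)) => [?|_ _]; first exact: cvg_cst.
have finj k k' t : `|k| <= r -> `|k'| <= r ->
   f (circle_point p k t) = f (circle_point p k' t) -> k = k'.
  move=> h h' /fi eq; apply: circle_point_inj (eq _ _); rewrite inE; exact: Dc.
have cp0 t : circle_point p 0 t = p.
  by rewrite /circle_point !mul0r !addr0 -surjective_pairing.
(* The distance from [f p] to the image of the circle, attained by compactness; the ball of this
   radius is the neighbourhood shown to be filled. *)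
have [d d0 dle] : exists2 d, 0 < d & forall P, cylinder P ->
    d <= `|f (circle_point p r P.2) - f p|.
  pose h P := `|f (circle_point p r P.2) - f p|.
  have hc : {within (@cylinder R), continuous h}.
    apply: continuous_in_subspaceT => P /set_mem KP.
    by apply: cvg_norm; apply: cvgB; [exact: fcr|exact: cvg_cst].
  have K0 : @cylinder R !=set0.
    by exists (0, 0); split; rewrite /= in_itv /= lexx ?ler01 ?ler0n.
  have [c /set_mem cK cmin] := compact_EVT_min K0 (@compact_cylinder R) hc.
  exists (h c); last by move=> P KP; apply: cmin; rewrite inE.
  rewrite normr_gt0 subr_eq0; apply/eqP; rewrite -[X in _ = f X](cp0 c.2) =>
      /(finj _ _ _ rn) h0.
  have := h0 _; rewrite normr0 ltW // => /(_ isT) req; by move: (r0);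
      rewrite [X in 0 < X]req ltxx.
apply/nbhs_ballP; exists d => // y; rewrite -ball_normE /= => yd.
apply: contrapT => ny.
(* Since [k1 - k2] is constantly [r], the two points compared by [F1] stay distinct while they move
   from a point of the circle and its centre to antipodal points of the circle of half the radius;
   [k3] shrinks the circle to [p]. *)
pose k1 (P : R * R) := r * (1 - P.1 / 2); pose k2 (P : R * R) := - (r * (P.1 / 2)).
pose k3 (P : R * R) := r * (1 - P.1).
have c1 : continuous k1.
  by move=> P; apply: cvgM; [exact: cvg_cst|apply: cvgB; [exact: cvg_cst|
     apply: cvgM; [exact: cvg_fst|exact: cvg_cst]]].
have c2 : continuous k2.
  by move=> P; apply: cvgN; apply: cvgM; [exact: cvg_cst|
     apply: cvgM; [exact: cvg_fst|exact: cvg_cst]].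
have c3 : continuous k3.
  by move=> P; apply: cvgM; [exact: cvg_cst|apply: cvgB; [exact: cvg_cst|
     exact: cvg_fst]].
have b1 P : cylinder P -> `|k1 P| <= r.
  case: P => s t [/=]; rewrite /k1 /= in_itv /= => /andP[s0 s1] _.
  by rewrite ler_norml; apply/andP; split; nra.
have b2 P : cylinder P -> `|k2 P| <= r.
  case: P => s t [/=]; rewrite /k2 /= in_itv /= => /andP[s0 s1] _.
  by rewrite ler_norml; apply/andP; split; nra.
have b3 P : cylinder P -> `|k3 P| <= r.
  case: P => s t [/=]; rewrite /k3 /= in_itv /= => /andP[s0 s1] _.
  by rewrite ler_norml; apply/andP; split; nra.
(* [F1] joins the loop around [f p] to the odd loop, [F2] moves the reference point from [f p] to
   the missed value [y], and [F3] contracts the loop, avoiding 0 because [y] is not attained. *)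
pose F1 P := f (circle_point p (k1 P) P.2) - f (circle_point p (k2 P) P.2).
pose F2 P := f (circle_point p r P.2) - (f p + P.1 *: (y - f p)).
pose F3 P := f (circle_point p (k3 P) P.2) - y.
have F1c P : cylinder P -> {for P, continuous F1}.
  by move=> KP; apply: cvgB; apply: fcc.
have F3c P : cylinder P -> {for P, continuous F3}.
  by move=> KP; apply: cvgB; [apply: fcc|exact: cvg_cst].
have F2c P : cylinder P -> {for P, continuous F2}.
  move=> KP; apply: cvgB; first exact: fcr.
  apply: cvgD; first exact: cvg_cst.
  by apply: cvgZ; [exact: cvg_fst|exact: cvg_cst].
have F1n P : cylinder P -> F1 P != 0.
  move=> KP; rewrite subr_eq0; apply/eqP => /finj /= h.
  have := h (b1 _ KP) (b2 _ KP); rewrite /k1 /k2; nra.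
have F3n P : cylinder P -> F3 P != 0.
  move=> KP; rewrite subr_eq0; apply/eqP => h; apply: ny.
  by exists (circle_point p (k3 P) P.2) => //; apply: Dc; exact: b3.
have F2n P : cylinder P -> F2 P != 0.
  move=> KP; rewrite subr_eq0; apply/eqP => h.
  have := dle _ KP; rewrite h [f p + _]addrC addrK normrZ leNgt => /negP; apply.
  case: KP => /=; rewrite in_itv /= => /andP[s0 s1] _.
  rewrite (le_lt_trans _ yd) // ger0_norm // distrC.
  by rewrite ler_piMl.
have n1 := winding_homotopy F1c F1n _.
have n2 := winding_homotopy F2c F2n _.
have n3 := winding_homotopy F3c F3n _.
have n4 := winding_odd F1c F1n _.
near \oo => n.
have /negP : turning (n.+1 + n.+1) (grid_loop n (fun t => F1 (1, t))) != 0.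
  near: n; apply: n4 => t.
  rewrite /F1 /= !circle_pointD1 opprB; congr (f _ - f _).
    by congr circle_point; rewrite /k1 /k2 /=; lra.
  by congr circle_point; rewrite /k1 /k2 /=; lra.
apply; apply/eqP.
have <- : turning (n.+1 + n.+1) (grid_loop n (fun t => F1 (0, t))) = 
  turning (n.+1 + n.+1) (grid_loop n (fun t => F1 (1, t))).
  near: n; apply: n1 => s; rewrite /F1 /=.
  by rewrite /k1 /k2 /= -!circle_point_period.
have -> : (fun t => F1 (0, t)) = (fun t => F2 (0, t)).
  apply: funext => t; rewrite /F1 /F2 /k1 /k2 /=.
  by rewrite mul0r subr0 mulr1 mulr0 oppr0 cp0 scale0r addr0.
have -> : turning (n.+1 + n.+1) (grid_loop n (fun t => F2 (0, t))) = 
  turning (n.+1 + n.+1) (grid_loop n (fun t => F2 (1, t))).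
  near: n; apply: n2 => s; rewrite /F2 /=.
  by rewrite -!circle_point_period.
have -> : (fun t => F2 (1, t)) = (fun t => F3 (0, t)).
  apply: funext => t; rewrite /F3 /F2 /k3 /=.
  by rewrite subr0 mulr1 scale1r [f p + _]addrC subrK.
have -> : turning (n.+1 + n.+1) (grid_loop n (fun t => F3 (0, t))) = 
  turning (n.+1 + n.+1) (grid_loop n (fun t => F3 (1, t))).
  near: n; apply: n3 => s; rewrite /F3 /=.
  by rewrite /k3 /= -!circle_point_period.
have -> : (fun t => F3 (1, t)) = (fun t => f p - y).
  apply: funext => t; rewrite /F3 /k3 /=.
  by rewrite subrr mulr0 cp0.
exact: turning_const.
Unshelve. all: by end_near.
Qed.

End InvarianceOfDomain.

(** * Local structure of a surface *)

Section Charts.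
Import Order.TTheory GRing.Theory Num.Theory.
Import numFieldNormedType.Exports.
Local Open Scope classical_set_scope.
Local Open Scope ring_scope.

Lemma nbhs_open_nbhs (T : topologicalType) (x : T) (A : set T) :
  nbhs x A -> exists2 B, open_nbhs x B & B `<=` A.
Proof. by rewrite nbhsE. Qed.

Lemma nbhs_set_typeP (T : topologicalType) (A : set T) (x : A) (U : set A) :
  nbhs x U <-> exists2 O, nbhs (val x) O & forall y : A, O (val y) -> U y.
Proof.
split.
  move=> /nbhs_open_nbhs[_ [[ O oO <-] Ox] OU].
  by exists O; [by apply: open_nbhs_nbhs; split| move=> y Oy; exact: OU].
case=> O /nbhs_open_nbhs[B [oB Bx] BO] OU.
rewrite nbhsE; exists (val @^-1` B); first by split => //; exists B.
by move=> y /= /BO; exact: OU.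
Qed.

Lemma val_continuous (T : topologicalType) (A : set T) : continuous (val : A -> T).
Proof. by move=> x N nN; apply/nbhs_set_typeP; exists N. Qed.

Variable R : realType.
Implicit Types (p q : R * R).

Definition row2 p : 'rV[R]_2 := \row_j (if j == ord0 then p.1 else p.2).
Definition coords2 (M : 'rV[R]_2) : R * R := (M ord0 ord0, M ord0 ord_max).

Lemma coords2K : cancel coords2 row2.
Proof.
move=> M; apply/matrixP => i j; rewrite mxE ord1 /=.
by case: j => [[|[|j]] hj] //=; congr (M _ _); apply: val_inj.
Qed.

Lemma row2K : cancel row2 coords2.
Proof. by case=> a b; rewrite /coords2 !mxE. Qed.

Lemma coords2_continuous : continuous coords2.
Proof. by move=> M; apply: pair_continuous; exact: coord_continuous. Qed.

Lemma row2_continuous : continuous row2.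
Proof.
move=> p A /= [P Pn PA].
have h : \forall q \near p, P ord0 ord0 q.1.
  by have := Pn ord0 ord0; rewrite /row2 [X in nbhs X]mxE /=; exact: cvg_fst.
have h' : \forall q \near p, P ord0 ord_max q.2.
  by have := Pn ord0 ord_max; rewrite /row2 [X in nbhs X]mxE /=; exact: cvg_snd.
suff : \forall q \near p, A (row2 q) by [].
apply: filterS2 h h' => q hq h'q; apply: PA => i j; rewrite ord1 mxE.
case: j => [[|[|j]] hj] //=.
  by rewrite (_ : Ordinal hj = ord0) //; apply: val_inj.
by rewrite (_ : Ordinal hj = ord_max) //; apply: val_inj.
Qed.

(* [h] and [k] take junk values outside [U] and [D]. *)
Lemma euclidean_chart (T : topologicalType) (X : set T) (x : T) :
  locally_euclidean R 2 X -> X x ->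
  exists (h : T -> R * R) (k : R * R -> T) (U : set T) (D : set (R * R)),
    [/\ U x, forall y, U y -> X y /\ within X (nbhs y) U,
     forall p, D p -> nbhs p D,
     forall y, U y -> [/\ D (h y), k (h y) = y & h @ within X (nbhs y) --> h y] &
     forall p, D p -> [/\ U (k p), h (k p) = p & {for p, continuous k}]].
Proof.
move=> hX Xx.
have [U0 [W0 [oU U0x oW [f [g [cf cg fg gf]]]]]] := hX (SigSub (mem_set Xx)).
pose h y : R * R := if pselect (X y) is left Xy then
  (if pselect (U0 (SigSub (mem_set Xy))) is left Uy
   then coords2 (val (f (SigSub (mem_set Uy)))) else 0) else 0.
pose k p : T := if pselect (W0 (row2 p)) is left Wp
   then val (val (g (SigSub (mem_set Wp)))) else x.
have hE (u : U0) : h (val (val u)) = coords2 (val (f u)).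
  rewrite /h; case: pselect => [Xy|]; last by move/(_ (set_valP (val u))).
  have e : SigSub (mem_set Xy) = val u by exact: val_inj.
  case: pselect => [Uy|]; last by rewrite e => /(_ (set_valP u)).
  by congr (coords2 (val (f _))); exact: val_inj.
have kE (w : W0) : k (coords2 (val w)) = val (val (g w)).
  rewrite /k; case: pselect => [Wp|]; last by rewrite coords2K => /(_ (set_valP w)).
  by congr (val (val (g _))); apply: val_inj; rewrite /= coords2K.
pose U y := exists u : U0, val (val u) = y.
pose D p := exists w : W0, coords2 (val w) = p.
exists h, k, U, D; split.
- by exists (SigSub (mem_set U0x)).
- move=> _ [u <-]; split; first exact: (set_valP (val u)).
  have /nbhs_set_typeP[ O nO OU] : nbhs (val u) U0.
    by apply: open_nbhs_nbhs; split => //; exact: set_valP.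
  rewrite /within /=; apply: filterS nO => y Oy Xy.
  have Uy := OU (SigSub (mem_set Xy)) Oy.
  by exists (SigSub (mem_set Uy)).
- move=> _ [w <-].
  have : nbhs (val w) W0 by apply: open_nbhs_nbhs; split => //; exact: (set_valP w).
  move=> nW0.
  have nW : \forall q \near coords2 (val w), W0 (row2 q).
    by apply: row2_continuous; rewrite coords2K.
  apply: filterS nW => q /= Wq.
  by exists (SigSub (mem_set Wq)); rewrite /= row2K.
- move=> _ [u <-]; split.
  + by exists (f u); rewrite hE.
  + by rewrite hE kE fg.
  + move=> N; rewrite hE => nN.
    have : nbhs u [set v | N (coords2 (val (f v)))].
      by have /val_continuous/cf := coords2_continuous nN.
    case/nbhs_set_typeP => O1 nO1 O1N.
    have nU0 : nbhs (val u) U0.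
      by apply: open_nbhs_nbhs; split => //; exact: set_valP.
    have : nbhs (val u) (O1 `&` U0) by exact: filterI.
    case/nbhs_set_typeP => O nO OU.
    rewrite /within /=; apply: filterS nO => y Oy Xy.
    have [ O1y Uy] := OU (SigSub (mem_set Xy)) Oy.
    by have := O1N (SigSub (mem_set Uy)) O1y; rewrite /= -hE.
- move=> _ [w <-]; split.
  + by exists (g w); rewrite kE.
  + by rewrite kE hE gf.
  + move=> N; rewrite kE => nN.
    have : nbhs w [set v | N (val (val (g v)))].
      by have /val_continuous/val_continuous/cg := nN.
    case/nbhs_set_typeP => O nO ON.
    have nW0 : nbhs (val w) W0.
      by apply: open_nbhs_nbhs; split => //; exact: (set_valP w).
    have : nbhs (val w) (O `&` W0) by exact: filterI.
    move=> nOW0.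
    have nOW : \forall q \near coords2 (val w), (O `&` W0) (row2 q).
      by apply: row2_continuous; rewrite coords2K.
    suff : \forall q \near coords2 (val w), N (k q) by [].
    apply: filterS nOW => q /= [ Oq Wq].
    have := ON (SigSub (mem_set Wq)) Oq.
    by rewrite /= -kE /= row2K.
Qed.

(** In a chart at [g p] the map becomes a planar injection; [invariance_of_domain] makes its image a
    neighbourhood, which the chart carries back to [X]. *)
Lemma open_disc_image (T : topologicalType) (X : set T) (g : R * R -> T) p E :
  locally_euclidean R 2 X -> nbhs p E ->
  (forall q, E q -> X (g q)) -> (forall q, E q -> {for q, continuous g}) ->
  {in E &, injective g} -> within X (nbhs (g p)) (g @` E).
Proof.
move=> hX /nbhs_open_nbhs[E' [oE' E'p] EE'] gX gc gi.
have [h [k [U [D [Ux UX Dn hU kD]]]]] := euclidean_chart hX (gX _ (EE' _ E'p)).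
pose E1 := [set q | E' q /\ U (g q)].
have nE' q : E' q -> nbhs q E' by move=> E'q; apply: open_nbhs_nbhs.
have nE1 q : E1 q -> nbhs q E1.
  move=> [E'q Uq]; have [_] := UX _ Uq; rewrite /within /= => nU.
  have := gc _ (EE' _ E'q) _ nU; have := nE' _ E'q; near_simpl.
  apply: filterS2 => r E'r; rewrite /= => Ur; split => //; apply: Ur.
  by apply: gX; exact: EE'.
have hg q : E1 q -> {for q, continuous (h \o g)}.
  move=> [E'q Uq] N; have [_ _ hc] := hU _ Uq.
  move=> /hc; rewrite /within /= => nN.
  have := gc _ (EE' _ E'q) _ nN; have := nE' _ E'q; near_simpl.
  by apply: filterS2 => r E'r; rewrite /=; apply; apply: gX; exact: EE'.
have hi : {in E1 &, injective (h \o g)}.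
  move=> q r /set_mem[E'q Uq] /set_mem[E'r Ur] /= e.
  apply: gi; rewrite ?inE; try exact: EE'.
  by have [_ <- _] := hU _ Uq; have [_ <- _] := hU _ Ur; rewrite e.
have := invariance_of_domain (nE1 _ (conj E'p Ux)) hg hi.
have [_ _ hc] := hU _ Ux => /hc.
have [_ nU] := UX _ Ux.
move: nU; rewrite /within /=; apply: filterS2 => y Uy hy Xy.
have [q [E'q Uq] /= e] := hy Xy; exists q; first exact: EE'.
by have [_ <- _] := hU _ (Uy Xy); have [_ <- _] := hU _ Uq; rewrite e.
Unshelve. all: by end_near.
Qed.

(** The inverse chart followed by [c] is a planar injection, to which [invariance_of_domain]
    applies. *)
Lemma open_coordinates (T : topologicalType) (X : set T) (c : T -> R * R) x O :
  locally_euclidean R 2 X -> X x -> nbhs x O -> continuous c ->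
  {in X `&` O &, injective c} -> nbhs (c x) (c @` (X `&` O)).
Proof.
move=> hX Xx /nbhs_open_nbhs[ O' [oO O'x] OO'] cc ci.
have [h [k [U [D [Ux UX Dn hU kD]]]]] := euclidean_chart hX Xx.
have [Dx kx _] := hU _ Ux.
have [_ _ kc] := kD _ Dx.
pose D1 := [set p | D p /\ O' (k p)].
have nD1 : nbhs (h x) D1.
  have : nbhs (k (h x)) O' by rewrite kx; apply: open_nbhs_nbhs.
  by move=> /kc; have := Dn _ Dx; near_simpl; apply: filterS2.
have ck q : D1 q -> {for q, continuous (c \o k)}.
  move=> [Dq _]; have [_ _ kcq] := kD _ Dq.
  by apply: continuous_comp => //; exact: cc.
have cki : {in D1 &, injective (c \o k)}.
  move=> q r /set_mem[Dq Oq] /set_mem[Dr Or] /= /ci e.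
  have [Uq <- _] := kD _ Dq; have [Ur <- _] := kD _ Dr.
  rewrite e // inE; split; try exact: OO'.
    exact: (UX _ Uq).1.
  exact: (UX _ Ur).1.
have := invariance_of_domain nD1 ck cki; rewrite /= kx; apply: filterS.
move=> _ [q [Dq Oq] <-]; exists (k q) => //; split; last exact: OO'.
by have [Uq _ _] := kD _ Dq; exact: (UX _ Uq).1.
Qed.

(* Two points of a punctured disc can be joined by at most two segments avoiding
   the centre. *)
Lemma punctured_disc_sign (phi : R * R -> R) o e :
  (forall p, ball o e p -> {for p, continuous phi}) ->
  (forall p, ball o e p -> phi p = 0 -> p = o) ->
  forall p q, ball o e p -> ball o e q -> 0 <= phi p * phi q.
Proof.
move=> pc p0 p q Bp Bq; rewrite leNgt; apply/negP => pq.
have e0 : 0 < e by case: Bp => /= h _; move: h; rewrite /ball /=; exact: le_lt_trans.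
(* By the intermediate value theorem, a segment along which [phi] changes sign passes through
   [o]. *)
have seg x y : ball o e x -> ball o e y -> phi x * phi y < 0 ->
    exists t, [/\ o.1 = x.1 + t * (y.1 - x.1), o.2 = x.2 + t * (y.2 - x.2) & phi o = 0].
  move=> Bx By xy.
  pose g (t : R) : R * R := (x.1 + t * (y.1 - x.1), x.2 + t * (y.2 - x.2)).
  have gB t : 0 <= t <= 1 -> ball o e (g t).
    case: Bx By => [Bx1 Bx2] [By1 By2] /andP[t0 t1].
    have cvx (a b : R) : 0 < a -> 0 < b -> 0 < a + t * (b - a).
      by move=> a0 b0; have [->|t1'] := eqVneq t 1; [lra|have : t < 1; [lra|nra]].
    move: Bx1 Bx2 By1 By2; rewrite /ball /= !ltr_norml.
    move=> /andP[a1 a2] /andP[a3 a4] /andP[b1 b2] /andP[b3 b4].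
    split; rewrite /ball /= ltr_norml; apply/andP; split.
    - have := cvx (o.1 - x.1 + e) (o.1 - y.1 + e); lra.
    - have := cvx (e - (o.1 - x.1)) (e - (o.1 - y.1)); lra.
    - have := cvx (o.2 - x.2 + e) (o.2 - y.2 + e); lra.
    - have := cvx (e - (o.2 - x.2)) (e - (o.2 - y.2)); lra.
  have gc : continuous g.
    move=> t.
    have lin a b : {for t, continuous (fun t : R => a + t * b : R)}.
      apply: cvgD; first exact: cvg_cst.
      by apply: cvgM; [exact: cvg_id|exact: cvg_cst].
    exact: (cvg_pair (lin _ _) (lin _ _)).
  have g0 : g 0 = x by rewrite /g !mul0r !addr0 -surjective_pairing.
  have g1 : g 1 = y by rewrite /g !mul1r ![_ + (_ - _)]addrC !subrK -surjective_pairing.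
  have := @IVT R (phi \o g) 0 1 0 ler01.
  case.
  - apply: continuous_in_subspaceT => t; rewrite inE /= in_itv /= => t01.
    by apply: continuous_comp; [exact: gc|apply: pc; exact: gB].
  - rewrite /= g0 g1 ge_min le_max; move: xy.
    by case: (leP (phi x) 0); case: (leP (phi y) 0) => //= hx hy; nra.
  - move=> t; rewrite in_itv /= => /gB Bt gt0; exists t.
    by rewrite -(p0 _ Bt gt0).
have [t [ o1 o2 phio]] := seg _ _ Bp Bq pq.
(* [r] is [o] displaced by a quarter of [q - p] turned through a right angle. It stays in the ball,
   and as [o] lies on the segment from [p] to [q], the segments from [r] to [p] and to [q] avoid
   [o]. *)
pose r : R * R := (o.1 - (q.2 - p.2) / 4, o.2 + (q.1 - p.1) / 4).
have Br : ball o e r.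
  case: Bp Bq => [Bx1 Bx2] [By1 By2]; move: Bx1 Bx2 By1 By2; rewrite /ball /= !ltr_norml.
  move=> /andP[? ?] /andP[? ?] /andP[? ?] /andP[? ?].
  by split; rewrite /ball /= ltr_norml; apply/andP; split; lra.
have r0 : phi r != 0.
  apply/eqP => /(p0 _ Br) ro.
  have e1 : r.1 = o.1 by rewrite ro.
  have e2 : r.2 = o.2 by rewrite ro.
  have pqe : p = q.
    by move: e1 e2; rewrite /r /= => e1 e2; apply/eqP; rewrite -pair_eqE /=;
      apply/andP; split; apply/eqP; lra.
  by move: pq; rewrite pqe; nra.
have nd : (q.1 - p.1) ^+ 2 + (q.2 - p.2) ^+ 2 != 0.
  rewrite paddr_eq0 ?sqr_ge0 // !sqrf_eq0 !subr_eq0; apply/negP => /andP[/eqP h1 /eqP h2].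
  have qp : q = p by rewrite (surjective_pairing p) -h1 -h2 -surjective_pairing.
  by move: pq; rewrite qp; nra.
have cross (d1 d2 t' s u v : R) : u = t' * d1 -> v = t' * d2 ->
    u = s * (u - d2 / 4) -> v = s * (v + d1 / 4) -> s * (d1 ^+ 2 + d2 ^+ 2) = 0.
  move=> eu ev e1 e2.
  have : d1 * v - d2 * u = 0 by rewrite eu ev; lra.
  by rewrite {1}e1 {1}e2 eu ev; lra.
have [pr|rq] : phi p * phi r < 0 \/ phi q * phi r < 0.
  by case: (ltgtP (phi r) 0) r0 => // h _; case: (ltgtP (phi p) 0) => h';
    by [left; nra|right; nra|move: pq; rewrite h' mul0r ltxx].
  have [s [ o3 o4 _]] := seg _ _ Bp Br pr.
  have : s * ((q.1 - p.1) ^+ 2 + (q.2 - p.2) ^+ 2) = 0.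
    by apply: (@cross _ _ t _ (o.1 - p.1) (o.2 - p.2)); move: o3 o4; rewrite /r /=; lra.
  move=> /eqP; rewrite mulf_eq0 (negbTE nd) orbF => /eqP s0.
  have po : p = o.
    by move: o3 o4; rewrite s0 !mul0r !addr0 => h1 h2;
        rewrite (surjective_pairing o) h1 h2 -surjective_pairing.
  by move: pr; rewrite po phio mul0r ltxx.
have [s [ o3 o4 _]] := seg _ _ Bq Br rq.
have : s * ((q.1 - p.1) ^+ 2 + (q.2 - p.2) ^+ 2) = 0.
  by apply: (@cross _ _ (t - 1) _ (o.1 - q.1) (o.2 - q.2)); move: o3 o4; rewrite /r /=;
      lra.
move=> /eqP; rewrite mulf_eq0 (negbTE nd) orbF => /eqP s0.
have po : q = o.
  by move: o3 o4; rewrite s0 !mul0r !addr0 => h1 h2;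
      rewrite (surjective_pairing o) h1 h2 -surjective_pairing.
by move: rq; rewrite po phio mul0r ltxx.
Qed.

(** A point does not separate a disc, which [punctured_disc_sign] expresses through signs; a chart
    carries this to [X]. *)
Lemma no_local_cut (T : topologicalType) (X : set T) (c : T -> R) x O :
  locally_euclidean R 2 X -> X x -> nbhs x O -> continuous c ->
  (forall y, X y -> O y -> c y = 0 -> y = x) ->
  exists2 N, nbhs x N & forall y z, X y -> N y -> X z -> N z -> 0 <= c y * c z.
Proof.
move=> hX Xx /nbhs_open_nbhs[ O' [oO O'x] OO'] cc cz.
have [h [k [U [D [Ux UX Dn hU kD]]]]] := euclidean_chart hX Xx.
have [Dx kx hc] := hU _ Ux.
have [_ _ kc] := kD _ Dx.
have : nbhs (h x) [set p | D p /\ O' (k p)].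
  have : nbhs (k (h x)) O' by rewrite kx; apply: open_nbhs_nbhs.
  by move=> /kc; have := Dn _ Dx; near_simpl; apply: filterS2.
move=> /nbhs_ballP[e /= e0 eD].
have sgn := @punctured_disc_sign (c \o k) (h x) e.
exists [set y | X y -> U y /\ ball (h x) e (h y)].
  have := hc _ (nbhsx_ballx (h x) _ e0); have [_] := UX _ Ux.
  by rewrite /within /=; apply: filterS2 => y Uy By Xy; split; [exact: Uy|exact: By].
move=> y z Xy /(_ Xy)[Uy By] Xz /(_ Xz)[Uz Bz].
have [_ <- _] := hU _ Uy; have [_ <- _] := hU _ Uz.
apply: sgn => // p Bp.
  have [Dp _] := eD _ Bp; have [_ _ kcp] := kD _ Dp.
  by apply: continuous_comp => //; exact: cc.
have [Dp Op] := eD _ Bp; have [Up hkp _] := kD _ Dp => /= ckp; rewrite -hkp; congr h.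
by apply: cz => //; [exact: (UX _ Up).1|exact: OO'].
Qed.

End Charts.

(** * Triangulated surfaces *)

Section SurfaceCombinatorics.
Import Order.TTheory GRing.Theory Num.Theory.
Import numFieldNormedType.Exports.
Local Open Scope classical_set_scope.
Local Open Scope ring_scope.
Variables (R : realType) (V : finType) (K : simplicial_complex V).
Implicit Types (y z : {ptws V -> R}) (s : {set V}).
Let X := realization R K.

Definition support y : {set V} := [set v : V | y v != 0]%SET.

Lemma in_support y v : (v \in support y) = (y v != 0).
Proof. by rewrite inE. Qed.

Lemma coordinate_continuous v : continuous (fun y : {ptws V -> R} => y v).
Proof. exact: (@proj_continuous V (fun=> R) v). Qed.

Lemma positive_nbhs y v : 0 < y v -> nbhs y [set z : {ptws V -> R} | 0 < z v].
Proof. by move=> yv; have /cvgr_gt/(_ _ yv) := @coordinate_continuous v y. Qed.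

Lemma ptws_continuous (T : topologicalType) (g : T -> {ptws V -> R}) x :
  (forall v, {for x, continuous (fun q => g q v)}) -> {for x, continuous g}.
Proof.
move=> gc; apply/cvg_sup => v A [_ [[B oB <-] Bx] BA].
have nB : nbhs (g x v) B by exact: open_nbhs_nbhs.
have h : \forall q \near x, B (g q v) by exact: gc nB.
suff : \forall q \near x, A (g q) by [].
by apply: filterS h => q Bq; exact: BA.
Qed.

Lemma sum_continuous (T : topologicalType) (P : pred V) (g : V -> T -> R) :
  (forall v, continuous (g v)) -> continuous (fun q => \sum_(v | P v) g v q).
Proof.
move=> gc q; elim: (index_enum V) => [|v r IH].
  rewrite (_ : (fun _ => _) = fun=> 0); first exact: cvg_cst.
  by apply/funext => x; rewrite big_nil.
rewrite (_ : (fun _ => _) = fun x => (if P v then g v x else 0) + \sum_(j <- r | P j) g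
    j x).
  apply: cvgD => //; case: ifP => _; [exact: gc|exact: cvg_cst].
by apply/funext => x; rewrite big_cons; case: ifP; rewrite ?add0r.
Qed.

Lemma coord_sum_continuous (P : pred V) :
  continuous (fun y : {ptws V -> R} => \sum_(v | P v) y v).
Proof.
by apply: (@sum_continuous _ _ (fun v y => y v)) => v; exact: coordinate_continuous.
Qed.

Lemma realization_sub y s : s \in faces K -> (forall v, 0 <= y v) ->
  \sum_v y v = 1 -> support y \subset s -> X y.
Proof.
move=> sF y0 y1 ys; split => //; apply: (faces_sub sF ys).
apply/negP => /eqP y00; have := oner_neq0 R; rewrite -y1 big1 ?eqxx // => v _.
apply/eqP; apply/negPn; rewrite -in_support y00; by rewrite inE.
Qed.

Lemma realization_face y s : X y -> s != finset.set0 ->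
  (forall v, v \in s -> y v != 0) -> s \in faces K.
Proof.
case=> _ _ yF s0 ys; apply: (faces_sub yF) => //.
by apply/fintype.subsetP => v /ys; rewrite in_support.
Qed.

Lemma sum_seq (r : seq V) (g : V -> R) : uniq r -> (forall v, v \notin r -> g v = 0) ->
  \sum_v g v = \sum_(v <- r) g v.
Proof.
move=> ur gr; transitivity (\sum_(v in r) g v); last by rewrite big_uniq.
rewrite [RHS]big_mkcond /=; apply: eq_bigr => v _.
by case: ifP => // /negbT/gr.
Qed.

Definition barycenter s : {ptws V -> R} := fun v => if v \in s then #|s|%:R^-1 else 0.

Lemma support_barycenter s : support (barycenter s) = s.
Proof.
apply/finset.setP => v; rewrite in_support /barycenter; case: ifP => vs; rewrite ?eqxx //.
rewrite invr_eq0 pnatr_eq0; apply/negP => /eqP/cards0_eq s0.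
by rewrite s0 inE in vs.
Qed.

Lemma barycenter_realization s : s \in faces K -> X (barycenter s).
Proof.
move=> sF; apply: (realization_sub sF); last by rewrite support_barycenter.
  by move=> v; rewrite /barycenter; case: ifP => // _; rewrite invr_ge0.
rewrite -big_mkcond /= sumr_const -[LHS]mulr_natr mulVf // pnatr_eq0 cards_eq0.
by apply: contraNneq (faces_neq0 K) => <-.
Qed.

(** Provides points of an arbitrarily small neighbourhood of [x] with positive weight on the support
    of [z]; a subset without such points cannot be a neighbourhood of [x] in [X]. *)
Lemma near_segment x z O : X x -> X z -> (support x :|: support z)%SET \in faces K ->
  nbhs x O -> exists y e, [/\ X y, O y, 0 < e < 1 & forall v,
      y v = (1 - e) * x v + e * z v].
Proof.
move=> Xx Xz xzF nO.
pose p (e : R) : {ptws V -> R} := fun v => (1 - e) * x v + e * z v.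
have pc : {for (0 : R), continuous p}.
  apply: ptws_continuous => v; rewrite /p; apply: cvgD; apply: cvgM;
      try exact: cvg_cst; try exact: cvg_id.
  by apply: cvgB; [exact: cvg_cst|exact: cvg_id].
have p0 : p 0 = x by apply/funext => v; rewrite /p subr0 mul1r mul0r addr0.
have /nbhs_ballP[d /= d0 dO] : nbhs (0 : R) (p @^-1` O) by apply: pc; rewrite p0.
pose e := Num.min (d / 2) (1 / 2).
have e0 : 0 < e by rewrite lt_min; lra.
have ed : e <= d / 2 by rewrite ge_min lexx.
have e1 : e <= 1 / 2 by rewrite ge_min lexx orbT.
have [x0 x1 _] := Xx; have [z0 z1 _] := Xz.
exists (p e), e; split => //; last by lra.
  apply: (realization_sub xzF) => [v||].
  - by rewrite /p addr_ge0 // mulr_ge0 //; lra.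
  - by rewrite big_split /= -!mulr_sumr x1 z1; lra.
  - apply/fintype.subsetP => v; rewrite finset.in_setU !in_support -negb_and;
      apply: contra => /andP[/eqP xv /eqP zv].
    by rewrite /p xv zv !mulr0 addr0.
by apply: dO; rewrite /ball /= sub0r normrN gtr0_norm //; lra.
Qed.

Hypothesis hX : locally_euclidean R 2 X.

(* Rules out vertices without edges and edges in fewer than two triangles. *)
Lemma no_boundary (c : {ptws V -> R} -> R * R) x O : X x -> nbhs x O -> continuous c ->
  {in X `&` O &, injective c} -> (forall y, X y -> 0 <= (c y).2) -> (c x).2 = 0 -> False.
Proof.
move=> Xx nO cc ci c0 cx.
have /nbhs_ballP[e /= e0 eD] := open_coordinates hX Xx nO cc ci.
have /eD : ball (c x) e ((c x).1, - (e / 2)).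
  split; rewrite /ball /= ?subrr ?normr0 // cx sub0r opprK gtr0_norm; lra.
by case=> y [Xy _] cy; have := c0 _ Xy; rewrite cy /=; lra.
Qed.

(** An isolated vertex would be the only point of [X] near it, so that even a constant map is
    injective there, against [no_boundary]. *)
Lemma vertex_in_edge a : exists2 b, b != a & [set a; b]%SET \in faces K.
Proof.
apply: contrapT => nb.
have Fb b : b != a -> [set a; b]%SET \in faces K -> False by move=> ba abF; apply: nb;
    exists b.
have Xa := barycenter_realization (vertex_face K a).
pose x := barycenter [set a]%SET.
have xa : x a = 1 by rewrite /x /barycenter inE eqxx cards1 invr1.
have nO : nbhs x [set y | 0 < y a].
  by apply: positive_nbhs; rewrite xa ltr01.
pose c y : R * R := (0, 0).
have cc : continuous c by exact: cst_continuous.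
suff ci : {in X `&` [set y | 0 < y a] &, injective c}.
  by apply: (no_boundary Xa nO cc ci) => [y _|]; rewrite /c.
have uniq y : X y -> 0 < y a -> y = x.
  move=> Xy ya; have y0 v : v != a -> y v = 0.
    move=> va; apply: contrapT => /eqP yv; apply: (Fb _ va); apply: (realization_face Xy).
      by apply/set0Pn; exists a; rewrite !inE eqxx.
    by move=> w; rewrite !inE => /orP[]/eqP-> //; rewrite gt_eqF.
  have [_ y1 _] := Xy; apply/funext => v; rewrite /x /barycenter inE cards1 invr1.
  case: eqVneq => [->|]; last exact: y0.
  by rewrite -y1 (bigD1 a) //= big1 ?addr0.
by move=> y z /set_mem[Xy ya] /set_mem[Xz za] _; rewrite (uniq y) // (uniq z).
Qed.

(** If the edge lay in at most one triangle, a point near its midpoint would be determined by its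
    weight at [a] and its total weight off the edge. The latter is nonnegative and vanishes at the
    midpoint, which [no_boundary] forbids. *)
Lemma edge_in_two_triangles a b : a != b -> [set a; b]%SET \in faces K ->
  exists c d, [/\ c != d, c \notin [set a; b]%SET, d \notin [set a; b]%SET,
    (c |: [set a; b])%SET \in faces K & (d |: [set a; b])%SET \in faces K].
Proof.
move=> ab abF; apply: contrapT => ncd.
have Xa := barycenter_realization abF.
pose x := barycenter [set a; b]%SET.
have xE v : x v = if v \in [set a; b]%SET then 1 / 2 else 0.
  by rewrite /x /barycenter cards2 ab div1r.
have nOv w : w \in [set a; b]%SET -> nbhs x [set y | 0 < y w].
  by move=> h; apply: positive_nbhs; rewrite xE h; lra.
have nO : nbhs x ([set y | 0 < y a] `&` [set y | 0 < y b]).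
  have na := nOv a (finset.set21 a b).
  have nb := nOv b (finset.set22 a b).
  exact: (@filterI _ _ (nbhs_filter x) _ _ na nb).
pose c y : R * R := (y a, \sum_(v | v \notin [set a; b]%SET) y v).
have cc : continuous c.
  move=> y; apply: pair_continuous; first exact: coordinate_continuous.
  exact: coord_sum_continuous.
suff ci : {in X `&` ([set y | 0 < y a] `&` [set y | 0 < y b]) &, injective c}.
  have := no_boundary Xa nO cc ci; apply; first by move=> y [y0 _ _]; exact: sumr_ge0.
  by rewrite /c /= big1 // => v vab; rewrite -/x xE (negbTE vab).
have third y u : X y -> 0 < y a -> 0 < y b -> u \notin [set a; b]%SET -> y u != 0 ->
    (u |: [set a; b])%SET \in faces K.
  move=> Xy ya yb uab yu; apply: (realization_face Xy).
    by apply/set0Pn; exists a; rewrite !inE eqxx orbT.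
  by move=> w; rewrite !inE => /orP[/eqP->//|/orP[]/eqP->]; rewrite gt_eqF.
(* By [ncd] there is at most one third vertex, common to all points with positive weights at [a] and
   [b]. *)
have same y z u w : X y -> 0 < y a -> 0 < y b -> X z -> 0 < z a -> 0 < z b ->
    u \notin [set a; b]%SET -> w \notin [set a; b]%SET -> y u != 0 -> z w != 0 -> u = w.
  move=> Xy ya yb Xz za zb uab wab yu zw; apply: contrapT => /eqP uw; apply: ncd.
  by exists u, w; split => //; [exact: third yu|exact: third zw].
have sumE y u : X y -> 0 < y a -> 0 < y b -> u \notin [set a; b]%SET -> y u != 0 ->
    \sum_(v | v \notin [set a; b]%SET) y v = y u.
  move=> Xy ya yb uab yu; rewrite (bigD1 u) //= big1 ?addr0 // => v /andP[vab vu].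
  apply: contrapT => /eqP yv; move: vu; rewrite (same y y v u) ?eqxx //.
have zero y z u : X y -> 0 < y a -> 0 < y b -> X z -> 0 < z a -> 0 < z b ->
    u \notin [set a; b]%SET ->
    c y = c z -> y u != 0 -> y u = z u.
  move=> Xy ya yb Xz za zb uab [_ eq2] yu; move: eq2; rewrite (sumE y u) // => eq2.
  have [zu|zu] := eqVneq (z u) 0; last by rewrite eq2 (sumE z u).
  move: yu; rewrite eq2 big1 ?eqxx // => v vab; apply: contrapT => /eqP zv.
  by move: (zv); rewrite (same z y v u) // ?zu ?eqxx // eq2; apply/eqP => /psumr_eq0P h;
    move: zv; rewrite h ?eqxx // => ? _; have [] := Xz.
move=> y z /set_mem[Xy [/= ya yb]] /set_mem[Xz [/= za zb]] cyz.
have out u : u \notin [set a; b]%SET -> y u = z u.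
  move=> uab; have [yu|yu] := eqVneq (y u) 0; last exact: zero yu.
  have [zu|zu] := eqVneq (z u) 0; first by rewrite yu zu.
  by apply/esym; apply: (zero z y u).
have [_ y1 _] := Xy; have [_ z1 _] := Xz.
have eqa : y a = z a by case: cyz.
have rest : \sum_(v | (v != a) && (v != b)) y v = \sum_(v | (v != a) && (v != b)) z v.
  by apply: eq_bigr => v /andP[va vb]; apply: out; rewrite !inE negb_or va vb.
have eqb : y b = z b.
  move: y1 z1; rewrite (bigD1 a) //= (bigD1 b) 1?eq_sym //= rest eqa => y1.
  by rewrite (bigD1 a) //= (bigD1 b) 1?eq_sym //=; lra.
apply/funext => u; have [|/out//] := boolP (u \in [set a; b]%SET).
by rewrite !inE => /orP[]/eqP->.
Qed.

Lemma bigD4 (a b c d : V) (g : V -> R) : uniq [:: a; b; c; d] ->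
  (forall v, v \notin [:: a; b; c; d] -> g v = 0) ->
  \sum_v g v = g a + g b + g c + g d.
Proof. by move=> u h; rewrite (sum_seq u h) !big_cons big_nil addr0 !addrA. Qed.

(** Of four vertices of a face, three span a triangle in which a disc around the barycentre is
    embedded, hence a neighbourhood in [X]; but the segment towards the fourth vertex leaves it at
    once. *)
Lemma face_card (s : {set V}) : s \in faces K -> (#|s| <= 3)%N.
Proof.
move=> sF; rewrite leqNgt; apply/negP => s4.
have [r [ur rs szr]] : exists r : seq V, [/\ uniq r, {subset r <= s} & size r = 4%N].
  exists (take 4 (enum s)); split; first exact: take_uniq (enum_uniq _).
    by move=> v /mem_take; rewrite mem_enum.
  by rewrite size_takel // -cardE.
case: r ur rs szr => [|a [|b [|c [|d []]]]] //= ur rs _.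
have fF (t : {set V}) : t != finset.set0 -> (forall v, v \in t -> v \in s) ->
    t \in faces K.
  by move=> t0 ts; apply: (faces_sub sF) => //; apply/fintype.subsetP.
have as_ : a \in s by apply: rs; rewrite inE eqxx.
have bs : b \in s by apply: rs; rewrite !inE eqxx orbT.
have cs : c \in s by apply: rs; rewrite !inE eqxx !orbT.
have ds : d \in s by apply: rs; rewrite !inE eqxx !orbT.
have abcF : [set a; b; c]%SET \in faces K.
  apply: fF => [|v]; first by apply/set0Pn; exists a; rewrite !inE eqxx.
  by rewrite !inE => /orP[/orP[]|]/eqP->.
have := ur; rewrite /= !inE !negb_or => /andP[/and3P[ab ac ad] /andP[/andP[bc bd]
    /andP[cd _]]].
have ba : b == a = false by rewrite eq_sym (negbTE ab).
have ca : c == a = false by rewrite eq_sym (negbTE ac).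
have cb : c == b = false by rewrite eq_sym (negbTE bc).
have da : d == a = false by rewrite eq_sym (negbTE ad).
have db : d == b = false by rewrite eq_sym (negbTE bd).
have dc : d == c = false by rewrite eq_sym (negbTE cd).
(* A parametrization of the triangle centred at its barycentre; for parameters below 1/10 the three
   weights stay positive. *)
pose g (p : R * R) : {ptws V -> R} := fun w => if w == a then 1 / 3 + p.1 else
  if w == b then 1 / 3 + p.2 else if w == c then 1 / 3 - p.1 - p.2 else 0.
have gc : continuous g.
  move=> p; apply: ptws_continuous => v; rewrite /g.
  have c1 : {for p, continuous (fun q : R * R => q.1)} by exact: cvg_fst.
  have c2 : {for p, continuous (fun q : R * R => q.2)} by exact: cvg_snd.
  case: (v == a); first by apply: cvgD; [exact: cvg_cst|exact: c1].
  case: (v == b); first by apply: cvgD; [exact: cvg_cst|exact: c2].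
  case: (v == c); last exact: cvg_cst.
  by apply: cvgB; [apply: cvgB; [exact: cvg_cst|exact: c1]|exact: c2].
pose E : set (R * R) := ball (0 : R * R) (1 / 10).
have gX p : E p -> X (g p).
  rewrite /E -ball_normE /= sub0r normrN pair_normE gt_max !ltr_norml =>
      /andP[/andP[h1 h2] /andP[h3 h4]].
  apply: (realization_sub abcF).
  - by move=> v; rewrite /g; case: (v == a); first lra; case: (v == b); first lra;
      case: (v == c); first lra.
  - rewrite (bigD4 ur) /g; last first.
      by move=> v; rewrite !inE !negb_or => /and4P[/negbTE-> /negbTE-> /negbTE-> _].
    by rewrite !eqxx ba ca cb da db dc; lra.
  - apply/fintype.subsetP => v; rewrite in_support /g !inE.
    by case: (v == a) => //; case: (v == b) => //; case: (v == c) => //; rewrite eqxx.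
have gi : {in E &, injective g}.
  move=> [p1 p2] [q1 q2] _ _ e.
  have := congr1 (fun y : {ptws V -> R} => y a) e; have := congr1 (fun y : {ptws V ->
      R} => y b) e.
  by rewrite /g !eqxx ba /= => /addrI-> /addrI->.
have e0 : 0 < 1 / 10 :> R by lra.
have X0 := gX 0 (ballxx _ e0).
have nE : nbhs (0 : R * R) E by exact: nbhsx_ballx.
have := open_disc_image hX nE gX (fun q _ => gc q) gi; rewrite /within /= => nO.
have Xd := barycenter_realization (vertex_face K d).
have [|y [e [Xy Oy /andP[he0 _] yE]]] := near_segment X0 Xd _ nO.
  apply: fF => [|v].
    by apply/set0Pn; exists d; rewrite finset.in_setU support_barycenter !inE eqxx orbT.
  rewrite finset.in_setU support_barycenter in_support /g !inE.
  case: (eqVneq v a) => [->|_]//; case: (eqVneq v b) => [->|_]//.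
  by case: (eqVneq v c) => [->|_]//; rewrite eqxx => /eqP->.
have [p _ gp] := Oy Xy.
have := yE d; rewrite -gp /g da db dc /barycenter inE eqxx cards1 invr1; lra.
Qed.

(** Two triangles glued along an edge contain a disc around its midpoint, a neighbourhood in [X] by
    [open_disc_image], which the segment towards a third apex would leave at once. *)
Lemma edge_in_at_most_two_triangles a b c d e : uniq [:: a; b; c; d; e] ->
  [set a; b; c]%SET \in faces K -> [set a; b; d]%SET \in faces K ->
  [set a; b; e]%SET \notin faces K.
Proof.
move=> ur cF dF; apply/negP => eF.
have := ur; rewrite /= !inE !negb_or.
move=> /andP[/and4P[ab ac ad ae] /andP[/and3P[bc bd be] /andP[/andP[cd ce] /andP[de _]]]].
have ur4 : uniq [:: a; b; c; d] by rewrite /= !inE !negb_or ab ac ad bc bd cd.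
have ba : b == a = false by rewrite eq_sym (negbTE ab).
have ca : c == a = false by rewrite eq_sym (negbTE ac).
have cb : c == b = false by rewrite eq_sym (negbTE bc).
have da : d == a = false by rewrite eq_sym (negbTE ad).
have db : d == b = false by rewrite eq_sym (negbTE bd).
have dc : d == c = false by rewrite eq_sym (negbTE cd).
have ea : e == a = false by rewrite eq_sym (negbTE ae).
have eb : e == b = false by rewrite eq_sym (negbTE be).
have ec : e == c = false by rewrite eq_sym (negbTE ce).
have ed : e == d = false by rewrite eq_sym (negbTE de).
(* [p.1] shifts weight along the edge; the positive and negative parts of [p.2] are the weights at
   [c] and [d], taken equally from [a] and [b]. *)
pose g (p : R * R) : {ptws V -> R} := fun w =>
  if w == a then 1 / 2 + p.1 - `|p.2| / 2 else
  if w == b then 1 / 2 - p.1 - `|p.2| / 2 else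
  if w == c then (`|p.2| + p.2) / 2 else if w == d then (`|p.2| - p.2) / 2 else 0.
have gc : continuous g.
  move=> p; apply: ptws_continuous => v; rewrite /g.
  have c1 : {for p, continuous (fun q : R * R => q.1)} by exact: cvg_fst.
  have c2 : {for p, continuous (fun q : R * R => q.2)} by exact: cvg_snd.
  have c3 : {for p, continuous (fun q : R * R => `|q.2|)} by apply: cvg_norm; exact: c2.
  have c4 : {for p, continuous (fun q : R * R => `|q.2| / 2)}.
    by apply: cvgM; [exact: c3|exact: cvg_cst].
  case: (v == a); first by apply: cvgB; [apply: cvgD;
      [exact: cvg_cst|exact: c1]|exact: c4].
  case: (v == b); first by apply: cvgB; [apply: cvgB;
      [exact: cvg_cst|exact: c1]|exact: c4].
  case: (v == c); first by apply: cvgM; [apply: cvgD;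
      [exact: c3|exact: c2]|exact: cvg_cst].
  case: (v == d); last exact: cvg_cst.
  by apply: cvgM; [apply: cvgB; [exact: c3|exact: c2]|exact: cvg_cst].
pose E : set (R * R) := ball (0 : R * R) (1 / 10).
have gX p : E p -> X (g p).
  rewrite /E -ball_normE /= sub0r normrN pair_normE gt_max !ltr_norml =>
      /andP[/andP[h1 h2] /andP[h3 h4]].
  have n2 : `|p.2| < 1 / 10 by rewrite ltr_norml h3 h4.
  have n0 := normr_ge0 p.2.
  have n3 := ler_norm p.2; have n4 := ler_norm (- p.2); rewrite normrN in n4.
  have sF : (if 0 <= p.2 then [set a; b; c] else [set a; b;
      d])%SET \in faces K by case: ifP.
  apply: (realization_sub sF).
  - by move=> v; rewrite /g; case: (v == a); first lra; case: (v == b); first lra;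
      case: (v == c); first lra; case: (v == d); first lra.
  - rewrite (bigD4 ur4) /g; last first.
      by move=> v; rewrite !inE !negb_or => /and4P[/negbTE-> /negbTE-> /negbTE->
          /negbTE->].
    by rewrite !eqxx ba ca cb da db dc; lra.
  - apply/fintype.subsetP => v; rewrite in_support /g.
    case: (leP 0 p.2) => p0; rewrite !inE; case: (v == a) => //; case: (v == b) => //;
        case: (v == c) => //;
      case: (v == d) => //; rewrite ?eqxx //.
      by rewrite ger0_norm // subrr mul0r eqxx.
    by rewrite ltr0_norm ?addNr ?mul0r ?eqxx.
have gi : {in E &, injective g}.
  move=> [p1 p2] [q1 q2] _ _ eqg.
  have ha := congr1 (fun y : {ptws V -> R} => y a) eqg.
  have hc := congr1 (fun y : {ptws V -> R} => y c) eqg.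
  have hd := congr1 (fun y : {ptws V -> R} => y d) eqg.
  move: ha hc hd; rewrite /g !eqxx ca cb da db dc /= => ha hc hd.
  have e2 : p2 = q2 by lra.
  by move: ha; rewrite e2 => ha; congr pair; lra.
have e0 : 0 < 1 / 10 :> R by lra.
have X0 := gX 0 (ballxx _ e0).
have nE : nbhs (0 : R * R) E by exact: nbhsx_ballx.
have := open_disc_image hX nE gX (fun q _ => gc q) gi; rewrite /within /= => nO.
have Xe := barycenter_realization (vertex_face K e).
have [|y [eps [Xy Oy /andP[he0 _] yE]]] := near_segment X0 Xe _ nO.
  apply: (faces_sub eF).
    apply/fintype.subsetP => v.
    rewrite finset.in_setU support_barycenter in_support /g !inE normr0.
    case: (v == a) => //; case: (v == b) => //; rewrite subr0 addr0 mul0r !if_same eqxx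
        /=.
    by case: (v == e); rewrite ?orbT.
  by apply/set0Pn; exists e; rewrite finset.in_setU support_barycenter !inE eqxx orbT.
have [p _ gp] := Oy Xy.
have := yE e; rewrite -gp /g ea eb ec ed /barycenter inE eqxx cards1 invr1; lra.
Qed.

(** Without such a triangle, the weight on [A] minus the weight off [A], both leaving out [a], would
    vanish near the vertex [a] only at [a]. It is positive towards [b] and negative towards [c],
    against [no_local_cut]. *)
Lemma link_connected a (A : {set V}) b c : b != a -> c != a -> b \in A -> c \notin A ->
  [set a; b]%SET \in faces K -> [set a; c]%SET \in faces K ->
  exists p q, [/\ p \in A, q \notin A, p != a, q != a & [set a; p; q]%SET \in faces K].
Proof.
move=> ba ca bA cA abF acF; apply: contrapT => npq.
pose x := barycenter [set a]%SET.
have Xx : X x := barycenter_realization (vertex_face K a).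
have xE v : x v = if v == a then 1 else 0.
  by rewrite /x /barycenter inE cards1 invr1.
pose inA v := (v \in A) && (v != a); pose outA v := (v \notin A) && (v != a).
pose f y : R := \sum_(v | inA v) y v - \sum_(v | outA v) y v.
have fc : continuous f.
  move=> y; apply: (@cvgB R R^o {ptws V -> R} (nbhs y) _
    (fun z => \sum_(v | inA v) z v) (fun z => \sum_(v | outA v) z v)).
    exact: coord_sum_continuous.
  exact: coord_sum_continuous.
have nO : nbhs x [set y | 0 < y a] by apply: positive_nbhs; rewrite xE eqxx.
have f0 y : X y -> 0 < y a -> f y = 0 -> y = x.
  move=> Xy ya /eqP; rewrite subr_eq0 => /eqP fy; have [y0 y1 _] := Xy.
  have zeroA : \sum_(v | inA v) y v = 0.
    apply: contrapT => /eqP nz; apply: npq.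
    have [p /andP[pA pa] yp] : exists2 p, inA p & y p != 0.
      by apply: contrapT => h; move: nz; rewrite big1 ?eqxx // => p Ap;
        apply: contrapT => /eqP yp; apply: h; exists p.
    have [q /andP[qA qa] yq] : exists2 q, outA q & y q != 0.
      by apply: contrapT => h; move: nz; rewrite fy big1 ?eqxx // => q Aq;
        apply: contrapT => /eqP yq; apply: h; exists q.
    exists p, q; split => //; apply: (realization_face Xy).
      by apply/set0Pn; exists a; rewrite !inE eqxx.
    by move=> v; rewrite !inE => /orP[/orP[]|]/eqP-> //; rewrite gt_eqF.
  have y0A v : inA v -> y v = 0 by move: v; apply: psumr_eq0P.
  have y0B v : outA v -> y v = 0 by move: v; apply: psumr_eq0P; rewrite -?fy.
  have y0' v : v != a -> y v = 0.
    by move=> va; case vA : (v \in A); [apply: y0A|apply: y0B]; rewrite /inA /outA vA va.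
  apply/funext => v; rewrite xE; case: (eqVneq v a) => [->|]; last exact: y0'.
  by rewrite -y1 (bigD1 a) //= big1 ?addr0.
have [N nN Npos] := no_local_cut hX Xx nO fc f0.
have Xb := barycenter_realization (vertex_face K b).
have Xc := barycenter_realization (vertex_face K c).
have segf w y e : w != a -> (forall v, y v = (1 - e) * x v + e * barycenter [set w]%SET
    v) ->
    y = fun v => if v == a then 1 - e else if v == w then e else 0.
  move=> wa ye; apply/funext => v; rewrite ye xE /barycenter inE cards1 invr1.
  case: (eqVneq v a) => [->|va]; first by rewrite eq_sym (negbTE wa); lra.
  by case: (v == w); lra.
have [|y [e [Xy Ny /andP[e0 _] yE]]] := near_segment Xx Xb _ nN.
  by rewrite !support_barycenter.
have [|z [e' [Xz Nz /andP[e'0 _] zE]]] := near_segment Xx Xc _ nN.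
  by rewrite !support_barycenter.
have := Npos _ _ Xy Ny Xz Nz.
have -> : f y = e.
  rewrite (segf _ _ _ ba yE) /f (bigD1 b) /=; last by rewrite /inA bA.
  rewrite (negbTE ba) eqxx !big1; first by lra.
    move=> v /andP[vA va]; rewrite (negbTE va); case: eqVneq vA => [->|//].
    by rewrite bA.
  by move=> v /andP[/andP[_ va] vb]; rewrite (negbTE va) (negbTE vb).
have -> : f z = - e'.
  rewrite (segf _ _ _ ca zE) /f [X in _ - X](bigD1 c) /=; last by rewrite /outA cA.
  rewrite (negbTE ca) eqxx !big1; first by lra.
    by move=> v /andP[/andP[_ va] vb]; rewrite (negbTE va) (negbTE vb).
  move=> v /andP[vA va]; rewrite (negbTE va); case: eqVneq vA => [->|//].
  by rewrite (negbTE cA).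
by nra.
Qed.

(** If no edge left [A], the total weight on [A] would take only the values 0 and 1 on [X], and its
    level set at 1 would be open, closed, nonempty and proper. *)
Lemma realization_connected (A : {set V}) a b : connected [set: X] -> a \in A ->
    b \notin A ->
  exists p q, [/\ p \in A, q \notin A & [set p; q]%SET \in faces K].
Proof.
move=> cX aA bA; apply: contrapT => npq.
pose f y : R := \sum_(v in A) y v.
have fc : continuous f.
  exact: coord_sum_continuous.
have f01 y : X y -> f y = 0 \/ f y = 1.
  move=> Xy; have [y0 y1 _] := Xy.
  have [|nz] := eqVneq (f y) 0; [by left|right].
  have [p pA yp] : exists2 p, p \in A & y p != 0.
    by apply: contrapT => h; move: nz; rewrite /f big1 ?eqxx // => p Ap;
      apply: contrapT => /eqP yp; apply: h; exists p.
  rewrite /f -y1 big_mkcond /=; apply: eq_bigr => q _.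
  case: ifP => // /negbT qA; apply/esym; apply: contrapT => /eqP yq.
  apply: npq; exists p, q; split => //; apply: (realization_face Xy).
    by apply/set0Pn; exists p; rewrite !inE eqxx.
  by move=> v; rewrite !inE => /orP[]/eqP->.
have fvc : continuous (fun y : X => f (val y)).
  by move=> y; apply: continuous_comp; [exact: val_continuous|exact: fc].
have Xa := barycenter_realization (vertex_face K a).
have Xb := barycenter_realization (vertex_face K b).
have fa : f (barycenter [set a]%SET) = 1.
  rewrite /f (bigD1 a) //= big1 /barycenter ?inE ?eqxx ?cards1 ?invr1 ?addr0 //.
  by move=> v /andP[_ va]; rewrite inE (negbTE va).
have fb : f (barycenter [set b]%SET) = 0.
  by rewrite /f big1 // => v vA; rewrite /barycenter inE; case: eqVneq vA bA => // -> ->.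
pose B : set X := [set y : X | f (val y) = 1].
have BE : B = [set: X].
  apply: cX.
  - by exists (SigSub (mem_set Xa)).
  - exists [set y : X | 1 / 2 < f (val y)].
      by have /continuousP oc := fvc; exact: (oc [set r | 1 / 2 < r] (@open_gt _ _)).
    rewrite setTI; apply/seteqP; split => y; rewrite /B /=; first by move=> ->; lra.
    by have [->|->] := f01 _ (set_valP y) => //; lra.
  - exists [set y : X | 1 / 2 <= f (val y)].
      by have /continuous_closedP oc := fvc; exact: (oc [set r | 1 / 2 <= r]
          (@closed_ge _ _)).
    rewrite setTI; apply/seteqP; split => y; rewrite /B /=; first by move=> ->; lra.
    by have [->|->] := f01 _ (set_valP y) => //; lra.
have : B (SigSub (mem_set Xb)) by rewrite BE.
by rewrite /B /= fb => /eqP; rewrite eq_sym oner_eq0.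
Qed.

End SurfaceCombinatorics.

(** * Intersection matrices *)

Section Triples.
Variable V : finType.
Implicit Types (x y z : V) (A : {set V}).

Definition triple x y z : {set V} := [set x; y; z]%SET.

Lemma in_triple v x y z : (v \in triple x y z) = [|| v == x, v == y | v == z].
Proof. by rewrite !inE orbA. Qed.

Lemma tripleC x y z : triple x y z = triple y x z.
Proof. by apply/finset.setP => v; rewrite !in_triple; do 3!case: (_ == _). Qed.

Lemma tripleCA x y z : triple x y z = triple x z y.
Proof. by apply/finset.setP => v; rewrite !in_triple; do 3!case: (_ == _). Qed.

Lemma tripleR x y z : triple y z x = triple x y z.
Proof. by rewrite tripleCA tripleC. Qed.

Lemma card_tripleI x y z A : uniq [:: x; y; z] ->
  #|triple x y z :&: A|%SET = (x \in A) + (y \in A) + (z \in A).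
Proof.
move=> u; have e : (triple x y z :&: A)%SET =i [seq v <- [:: x; y; z] | v \in A].
  by move=> v; rewrite mem_filter finset.in_setI in_triple andbC !inE.
rewrite (eq_card e) (card_uniqP _) ?filter_uniq // size_filter /=.
by rewrite addn0 !addnA.
Qed.

Lemma card_triple x y z : #|triple x y z| = 3 <-> uniq [:: x; y; z].
Proof.
split=> [h|u]; last by rewrite -[triple _ _ _]finset.setIid card_tripleI // !in_triple
    !eqxx !orbT.
have e : triple x y z =i [:: x; y; z] by move=> v; rewrite in_triple !inE.
by apply/card_uniqP; rewrite -(eq_card e).
Qed.

Lemma card3_triple A : #|A| = 3 -> exists x y z, A = triple x y z.
Proof.
rewrite cardE; have: enum A =i A by move=> v; rewrite mem_enum.
case: (enum A) => [|x [|y [|z []]]] // e _; exists x, y, z.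
by apply/finset.setP => v; rewrite -e in_triple !inE.
Qed.

Lemma triple_of_card A x y z : #|A| = 3 -> uniq [:: x; y; z] ->
  x \in A -> y \in A -> z \in A -> A = triple x y z.
Proof.
move=> A3 u xA yA zA; apply/eqP; rewrite eq_sym eqEcard A3 (proj2 (card_triple x y z))
    // leqnn andbT.
by apply/fintype.subsetP => v; rewrite in_triple => /or3P[]/eqP->.
Qed.

Lemma third_vertex A x y : #|A| = 3 -> x != y -> x \in A -> y \in A ->
  exists z, A = triple x y z.
Proof.
move=> A3 xy xA yA; have : #|A :\ x :\ y|%SET = 1.
  by move: A3; rewrite (cardsD1 x) xA (cardsD1 y) !inE eq_sym xy yA; case.
move=> /eqP/cards1P[z ez]; exists z.
have : z \in (A :\ x :\ y)%SET by rewrite ez inE.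
rewrite !inE => /and3P[zy zx zA]; apply: triple_of_card => //.
by rewrite /= !inE negb_or xy eq_sym zx eq_sym zy.
Qed.

End Triples.

(** What is kept of the topology. [triangle_adjacent] and [triangle_third] together put each edge in
    exactly two triangles; the connectedness fields are induction principles, propagating a property
    across the edges at [x] or across all edges. *)
Record combinatorial_surface (V : finType) (T : {set {set V}}) : Prop :=
    CombinatorialSurface {
  triangle_card : forall t, t \in T -> #|t| = 3;
  triangle_adjacent : forall x y z, triple x y z \in T ->
    exists2 d, d != z & triple x y d \in T;
  triangle_third : forall x y z d e, triple x y z \in T -> triple x y d \in T ->
    triple x y e \in T -> d != z -> e != z -> d = e;
  star_connected : forall x (P : {set V} -> Prop),
    (forall y z d, triple x y z \in T -> triple x y d \in T -> P (triple x y z) ->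
        P (triple x y d)) ->
    forall y z y' z', triple x y z \in T -> triple x y' z' \in T -> P (triple x y z) ->
        P (triple x y' z');
  surface_connected : forall (P : {set V} -> Prop),
    (forall x y z d, triple x y z \in T -> triple x y d \in T -> P (triple x y z) ->
        P (triple x y d)) ->
    forall t t', t \in T -> t' \in T -> P t -> P t';
  vertex_in_triangle : forall x, exists y z, triple x y z \in T }.

(* A bijection between triangles preserving the intersection matrix, as a
   relation, so that the inverse bijection is obtained by flipping arguments. *)
Record matching (V V' : finType) (T : {set {set V}}) (T' : {set {set V'}})
    (m : {set V} -> {set V'} -> Prop) : Prop := Matching {
  matching_l : forall t t', m t t' -> t \in T;
  matching_r : forall t t', m t t' -> t' \in T';
  matching_total_l : forall t, t \in T -> exists t', m t t';
  matching_total_r : forall t', t' \in T' -> exists t, m t t';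
  matching_card : forall t t' s s', m t t' -> m s s' ->
      #|t :&: s|%SET = #|t' :&: s'|%SET }.

Definition converse (A B : Type) (m : A -> B -> Prop) b a := m a b.

Lemma matching_converse (V V' : finType) (T : {set {set V}}) (T' : {set {set V'}}) m :
  matching T T' m -> matching T' T (converse m).
Proof.
case=> h1 h2 h3 h4 h5; split=> [t t' /h2|t t' /h1|//|//|t t' s s' h k] //.
by rewrite (h5 _ _ _ _ h k).
Qed.

Ltac split_and := repeat match goal with
  | H : is_true (_ && _) |- _ => case/andP: H => ? ? end.

Ltac split_uniq H := move: H; rewrite /= !inE !negb_or => H; split_and.

Ltac use_neq := repeat match goal with
  | H : is_true (?a != ?b) |- context [?a == ?b] => rewrite (negbTE H)
  | H : is_true (?a != ?b) |- context [?b == ?a] => rewrite [b == a]eq_sym (negbTE H)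
  | |- context [?a == ?a] => rewrite eqxx
  end.

Lemma omitted_vertex (V : finType) (t s : {set V}) : #|t| = 3 -> #|t :&: s|%SET = 2 ->
  exists2 z, z \in t & z \notin s.
Proof.
move=> t3 ts; have : (0 < #|t :\: s|%SET)%N by rewrite cardsD t3 ts.
by rewrite card_gt0 => /set0Pn[z]; rewrite !inE => /andP[]; exists z.
Qed.

Lemma shared_edge (V : finType) x y z (s : {set V}) : uniq [:: x; y; z] -> #|s| = 3 ->
  #|triple x y z :&: s|%SET = 2 -> z \notin s -> exists2 d, d != z & s = triple x y d.
Proof.
move=> u s3; rewrite card_tripleI // => c /[dup] zs /negbTE z0; move: c; rewrite z0 addn0.
case xs: (x \in s); case ys: (y \in s) => // _.
have [|d ed] := third_vertex s3 _ xs ys; first by split_uniq u.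
by exists d => //; apply: contra zs => /eqP <-; rewrite ed in_triple eqxx !orbT.
Qed.

Lemma same_omitted (V : finType) (T : {set {set V}}) (t s1 s2 : {set V}) z :
  combinatorial_surface T -> t \in T -> s1 \in T -> s2 \in T ->
  #|t :&: s1|%SET = 2 -> #|t :&: s2|%SET = 2 -> z \in t -> z \notin s1 ->
      z \notin s2 -> s1 = s2.
Proof.
move=> sT tT s1T s2T c1 c2 zt z1 z2.
have t3 := triangle_card sT tT.
have [x [y te]] : exists x y, t = triple x y z.
  have [a [b [c e]]] := card3_triple t3.
  move: zt; rewrite e in_triple => /or3P[]/eqP->.
  - by exists b, c; rewrite tripleC tripleCA tripleC; apply/finset.setP => v;
      rewrite !in_triple; do 3!case: (_ == _).
  - by exists a, c; rewrite tripleCA.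
  - by exists a, b.
have u : uniq [:: x; y; z] by apply/card_triple; rewrite -te.
rewrite te in c1 c2.
have [d1 n1 e1] := shared_edge u (triangle_card sT s1T) c1 z1.
have [d2 n2 e2] := shared_edge u (triangle_card sT s2T) c2 z2.
rewrite te in tT; rewrite e1 in s1T; rewrite e2 in s2T.
by rewrite e1 e2 (triangle_third sT tT s1T s2T n1 n2).
Qed.

Ltac elim_eqs := repeat match goal with
  | H : is_true (?a != ?a) |- _ => exfalso; move: H; rewrite eqxx; done
  | H : is_true (?a == ?a) |- _ => clear H
  | H : is_true (?a == ?b) |- _ => move/eqP: H => H; first [subst a | subst b]
  | H : is_true (_ || _) |- _ => case/orP: H => H
  end.

(** * Correspondence of the corners of matched triangles *)

Section Matching.
Variables (V V' : finType) (T : {set {set V}}) (T' : {set {set V'}}).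
Variable (m : {set V} -> {set V'} -> Prop).
Hypotheses (sT : combinatorial_surface T) (sT' : combinatorial_surface T').
Hypothesis (mT : matching T T' m).

Lemma triangle_uniq x y z : triple x y z \in T -> uniq [:: x; y; z].
Proof. by move=> /(triangle_card sT)/card_triple. Qed.

(** Only the underlying sets are compared; the order of the vertices acquires a meaning in
    [corner_matched]. *)
Definition matched (x y z : V) (x' y' z' : V') := m (triple x y z) (triple x' y' z').

Lemma matched_in x y z x' y' z' : matched x y z x' y' z' -> triple x y z \in T.
Proof. exact: matching_l mT _ _. Qed.

Lemma matched_in' x y z x' y' z' : matched x y z x' y' z' -> triple x' y' z' \in T'.
Proof. exact: matching_r mT _ _. Qed.

Lemma matched_uniq x y z x' y' z' : matched x y z x' y' z' -> uniq [:: x; y; z].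
Proof. by move=> /matched_in/triangle_uniq. Qed.

Lemma matched_uniq' x y z x' y' z' : matched x y z x' y' z' -> uniq [:: x'; y'; z'].
Proof. by move=> /matched_in'/(triangle_card sT')/card_triple. Qed.

(** Intersection numbers as sums of booleans: once known inequalities are rewritten, the equation
    decides the remaining coincidences of vertices. *)
Lemma matched_count x y z x' y' z' u v w u' v' w' :
  matched x y z x' y' z' -> matched u v w u' v' w' ->
  ([|| x == u, x == v | x == w] + [|| y == u, y == v | y == w] + [|| z == u,
      z == v | z == w])%N =
  ([|| x' == u', x' == v' | x' == w'] + [|| y' == u', y' == v' | y' == w'] +
   [|| z' == u', z' == v' | z' == w'])%N.
Proof.
move=> h k; have := matching_card mT h k.
by rewrite !card_tripleI ?(matched_uniq h) ?(matched_uniq' h) // !in_triple.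
Qed.

Lemma matchedC x y z x' y' z' : matched x y z x' y' z' -> matched y x z y' x' z'.
Proof. by rewrite /matched tripleC [triple x' y' z']tripleC. Qed.

Lemma matchedCA x y z x' y' z' : matched x y z x' y' z' -> matched x z y x' z' y'.
Proof. by rewrite /matched tripleCA [triple x' y' z']tripleCA. Qed.

(** [z] and [z'] fix the near sides of the edges: the triangles beyond [xy] and beyond [x'y']
    correspond. *)
Definition edge_matched x y z x' y' z' :=
  exists d d', [/\ d != z, d' != z' & matched x y d x' y' d'].

Lemma edge_matchedC x y z x' y' z' : edge_matched x y z x' y' z' ->
    edge_matched y x z y' x' z'.
Proof. by case=> d [d' [h1 h2 /matchedC h3]]; exists d, d'. Qed.

(* Vertices correspond to each other when the opposite edges do. *)
Definition corner_matched x y z x' y' z' :=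
  [/\ matched x y z x' y' z', edge_matched x y z x' y' z',
      edge_matched x z y x' z' y' & edge_matched y z x y' z' x'].

Lemma corner_matchedC x y z x' y' z' : corner_matched x y z x' y' z' ->
    corner_matched y x z y' x' z'.
Proof.
by case=> h1 h2 h3 h4; split => //; [exact: matchedC|exact: edge_matchedC].
Qed.

Lemma corner_matchedCA x y z x' y' z' : corner_matched x y z x' y' z' ->
    corner_matched x z y x' z' y'.
Proof.
by case=> h1 h2 h3 h4; split => //; [exact: matchedCA|exact: edge_matchedC].
Qed.

Lemma triangle_eq (W : finType) (t s : {set W}) : #|t| = 3 -> #|s| = 3 ->
    #|t :&: s|%SET = 3 -> t = s.
Proof.
move=> t3 s3 c; apply/eqP; rewrite eqEcard t3 s3 leqnn andbT.
by apply/finset.setIidPl/eqP; rewrite eqEcard finset.subsetIl c t3.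
Qed.

Lemma matching_inj t s t' : m t t' -> m s t' -> t = s.
Proof.
move=> h k; have c := matching_card mT h k.
apply: triangle_eq; first exact: triangle_card sT _ (matching_l mT h).
  exact: triangle_card sT _ (matching_l mT k).
by rewrite c finset.setIid; exact: triangle_card sT' _ (matching_r mT h).
Qed.

Lemma matching_fun t s' t' : m t s' -> m t t' -> s' = t'.
Proof.
move=> h k; have c := matching_card mT h k.
apply: triangle_eq; first exact: triangle_card sT' _ (matching_r mT h).
  exact: triangle_card sT' _ (matching_r mT k).
by rewrite -c finset.setIid; exact: triangle_card sT _ (matching_l mT h).
Qed.

Lemma adjacent_card x y z d : triple x y z \in T -> triple x y d \in T -> d != z ->
  #|triple x y z :&: triple x y d|%SET = 2.
Proof.
move=> h /triangle_uniq k dz; rewrite card_tripleI ?triangle_uniq // !in_triple !eqxx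
    !orbT /=.
by have {}h := triangle_uniq h; split_uniq h; use_neq.
Qed.

(** The images of the three neighbours are adjacent to the image triangle and omit one vertex each.
    These vertices are distinct: equal ones would give equal images by [same_omitted], hence equal
    neighbours by [matching_inj]. Each is paired with the vertex omitted by the original
    neighbour. *)
Lemma corner_exists x y z : triple x y z \in T -> exists x' y' z',
    corner_matched x y z x' y' z'.
Proof.
move=> tT; have u := triangle_uniq tT; split_uniq u.
have tT2 : triple x z y \in T by rewrite tripleCA.
have tT3 : triple y z x \in T by rewrite tripleCA tripleC.
have [d1 n1 s1] := triangle_adjacent sT tT.
have [d2 n2 s2] := triangle_adjacent sT tT2.
have [d3 n3 s3] := triangle_adjacent sT tT3.
have [t' mt] := matching_total_l mT tT.
have mt2 : m (triple x z y) t' by rewrite tripleCA.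
have mt3 : m (triple y z x) t' by rewrite tripleCA tripleC.
have [s1' m1] := matching_total_l mT s1.
have [s2' m2] := matching_total_l mT s2.
have [s3' m3] := matching_total_l mT s3.
have t'T := matching_r mT mt.
have [s1T s2T s3T] := And3 (matching_r mT m1) (matching_r mT m2) (matching_r mT m3).
have c1 := adjacent_card tT s1 n1; rewrite (matching_card mT mt m1) in c1.
have c2 := adjacent_card tT2 s2 n2; rewrite (matching_card mT mt2 m2) in c2.
have c3 := adjacent_card tT3 s3 n3; rewrite (matching_card mT mt3 m3) in c3.
have t'3 := triangle_card sT' t'T.
have [z' zt zs] := omitted_vertex t'3 c1.
have [y' yt ys] := omitted_vertex t'3 c2.
have [x' xt xs] := omitted_vertex t'3 c3.
have yz : y' != z'.
  apply: contraNneq n1 => e; rewrite e in yt ys.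
  have e12 := same_omitted sT' t'T s1T s2T c1 c2 zt zs ys; rewrite -e12 in m2.
  have := matching_inj m1 m2 => eS; have : z \in triple x y d1 by rewrite eS in_triple
      eqxx orbT.
  by rewrite in_triple; use_neq => /=; rewrite eq_sym.
have xz : x' != z'.
  apply: contraNneq n1 => e; rewrite e in xt xs.
  have e12 := same_omitted sT' t'T s1T s3T c1 c3 zt zs xs; rewrite -e12 in m3.
  have := matching_inj m1 m3 => eS; have : z \in triple x y d1 by rewrite eS in_triple
      eqxx orbT.
  by rewrite in_triple; use_neq => /=; rewrite eq_sym.
have xy : x' != y'.
  apply: contraNneq n2 => e; rewrite e in xt xs.
  have e12 := same_omitted sT' t'T s2T s3T c2 c3 yt ys xs; rewrite -e12 in m3.
  have := matching_inj m2 m3 => eS; have : y \in triple x z d2 by rewrite eS in_triple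
      eqxx.
  by rewrite in_triple; use_neq => /=; rewrite eq_sym.
have u' : uniq [:: x'; y'; z'] by rewrite /= !inE negb_or xy xz yz.
have te := triple_of_card t'3 u' xt yt zt.
exists x', y', z'; rewrite te in mt mt2 mt3 c1 c2 c3.
rewrite [triple x' y' z']tripleCA in c2.
have e3 : triple x' y' z' = triple y' z' x' by rewrite tripleC tripleCA.
rewrite e3 in c3.
have u2 : uniq [:: x'; z'; y'] by rewrite /= !inE negb_or xz xy eq_sym yz.
have u3 : uniq [:: y'; z'; x'] by rewrite /= !inE negb_or yz eq_sym xy eq_sym xz.
have [e1 ne1 E1] := shared_edge u' (triangle_card sT' s1T) c1 zs.
have [e2 ne2 E2] := shared_edge u2 (triangle_card sT' s2T) c2 ys.
have [e3' ne3 E3] := shared_edge u3 (triangle_card sT' s3T) c3 xs.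
by split => //; [exists d1, e1; rewrite /matched -E1|exists d2, e2; rewrite /matched -E2
  |exists d3, e3'; rewrite /matched -E3].
Qed.

(** The neighbour of the second triangle across [xy] is the first one, so the images of [x] and [y]
    as corners of the second lie in both image triangles and are [x'] and [y'] in some order. *)
Lemma edge_cases x y a x' y' a' : corner_matched x y a x' y' a' ->
  exists b b', [/\ b != a, b' != a' &
    corner_matched x y b x' y' b' \/ corner_matched x y b y' x' b'].
Proof.
case=> h [d [d' [da d'a' k]]] _ _.
have [p [q [r c]]] := corner_exists (matched_in k).
have [c1 [e [e' [ed e'r c2]]] _ _] := c.
have ea : e = a.
  by apply: (triangle_third sT (matched_in k) (matched_in c2) (matched_in h));
      rewrite // eq_sym.
rewrite ea in c2.
have E1 := matching_fun k c1; have E2 := matching_fun h c2.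
have u1 := matched_uniq' k; have u2 := matched_uniq' h; have u3 := matched_uniq' c1.
exists d, d'; split => //.
have p1 : p \in triple x' y' d' by rewrite E1 in_triple eqxx.
have p2 : p \in triple x' y' a' by rewrite E2 in_triple eqxx.
have q1 : q \in triple x' y' d' by rewrite E1 in_triple eqxx orbT.
have q2 : q \in triple x' y' a' by rewrite E2 in_triple eqxx orbT.
have r1 : r \in triple x' y' d' by rewrite E1 in_triple eqxx !orbT.
clear E1 E2 k h c1 c2; rewrite !in_triple in p1 p2 q1 q2 r1.
by split_uniq u1; split_uniq u2; split_uniq u3; elim_eqs; auto.
Qed.

(** [x'] is the vertex of the image triangle missed by the image of the neighbour across [yz], a
    description that leaves no choice. *)
Lemma corner_fun x y z x' y' z' p q r : corner_matched x y z x' y' z' ->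
  corner_matched x y z p q r -> x' = p.
Proof.
case=> h1 _ _ [d [d' [n n' k]]] [h2 _ _ [e [e' [ne ne' l]]]].
have tT : triple y z x \in T by rewrite tripleR; exact: matched_in h1.
have ed := triangle_third sT tT (matched_in l) (matched_in k) ne n; rewrite ed in l.
have E1 := matching_fun h1 h2; have E2 := matching_fun k l.
have u1 := matched_uniq' h1; have u2 := matched_uniq' k.
have x1 : x' \in triple p q r by rewrite -E1 in_triple eqxx.
have : x' \notin triple q r e'.
  by rewrite -E2 in_triple; split_uniq u1; use_neq.
rewrite !in_triple !negb_or in x1 * => ?; split_and; by elim_eqs.
Qed.

End Matching.

Section Twisted.
Variables (V V' : finType) (T : {set {set V}}) (T' : {set {set V'}}).
Variable (m : {set V} -> {set V'} -> Prop).
Hypotheses (sT : combinatorial_surface T) (sT' : combinatorial_surface T').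
Hypothesis (mT : matching T T' m).

Lemma edge_matched_converse x y z x' y' z' :
  edge_matched m x y z x' y' z' -> edge_matched (converse m) x' y' z' x y z.
Proof. by case=> d [d' [h1 h2 h3]]; exists d', d. Qed.

Lemma corner_matched_converse x y z x' y' z' :
  corner_matched m x y z x' y' z' -> corner_matched (converse m) x' y' z' x y z.
Proof.
by case=> h1 h2 h3 h4; split => //; exact: edge_matched_converse.
Qed.

Lemma third_eq (W : finType) (U : {set {set W}}) x y a b c : combinatorial_surface U ->
  triple x y a \in U -> triple x y b \in U -> triple x y c \in U -> a != b -> a != c ->
      b = c.
Proof.
by move=> sU h1 h2 h3 ab ac; apply: (triangle_third sU h1 h2 h3); rewrite eq_sym.
Qed.

(** If [z] were [b], then [xaz] and [xbr] would be the same triangle, since the edge [xb] has only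
    [y] and [a] opposite to it; but [x'] lies in just one of the images. *)
Lemma twisted_step x y a b z r x' y' a' b' z' r' :
  matched m x y a x' y' a' -> matched m x y b x' y' b' -> matched m x a z x' a' z' ->
  matched m x b r y' b' r' -> a != b -> z != y -> r != y -> z' != y' -> r' != x' ->
      z != b.
Proof.
move=> h1 h2 h3 h4 ab zy ry zy' rx'; apply: contraT; rewrite negbK => /eqP zb;
    rewrite zb in h3.
have u1 := matched_uniq sT mT h1; have u2 := matched_uniq' sT' mT h1.
have v1 := matched_uniq sT mT h2; have v2 := matched_uniq' sT' mT h2.
have ar : a = r.
  have e1 : triple x b y \in T by rewrite tripleCA; exact: (matched_in mT h2).
  have e2 : triple x b a \in T by rewrite tripleCA; exact: (matched_in mT h3).
  by apply: (third_eq sT e1 e2 (matched_in mT h4)); [split_uniq u1|rewrite eq_sym].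
rewrite -ar in h4; have := matched_count sT sT' mT h3 h4.
split_uniq u1; split_uniq u2; split_uniq v1; split_uniq v2; use_neq => /=.
by do 4!case: (_ == _).
Qed.

End Twisted.

Ltac break_uniqs := repeat match goal with
  | H : is_true (uniq _) |- _ => move: H; rewrite /= !(inE, negb_or) => H; split_and
  end.

Ltac prove_uniq := break_uniqs; rewrite /=; try rewrite !(inE, negb_or); use_neq.

(* The edge [xy] is twisted: going from [xya] to [xyb] the corners exchange [x']
   and [y'].  The last four fields are the outer neighbours of these triangles. *)
Record twisted_config (V V' : finType) (m : {set V} -> {set V'} -> Prop)
    x y a b z w x' y' a' b' z' w' : Prop := TwistedConfig {
  tw_uniq : uniq [:: x; y; a; b; z; w];
  tw_uniq' : uniq [:: x'; y'; a'; b'; z'; w'];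
  tw_a : corner_matched m x y a x' y' a';
  tw_b : corner_matched m x y b y' x' b';
  tw_p : matched m x a z x' a' z';
  tw_q : matched m y a w y' a' w';
  tw_r : matched m x b w y' b' z';
  tw_u : matched m y b z x' b' w' }.

Lemma twisted_configC (V V' : finType) (m : {set V} -> {set V'} -> Prop)
    x y a b z w x' y' a' b' z' w' :
  twisted_config m x y a b z w x' y' a' b' z' w' ->
  twisted_config m y x a b w z y' x' a' b' w' z'.
Proof.
case=> u u' h1 h2 h3 h4 h5 h6; split => //.
- by prove_uniq.
- by prove_uniq.
- exact: corner_matchedC.
- exact: corner_matchedC.
Qed.

Lemma twisted_config_swap (V V' : finType) (m : {set V} -> {set V'} -> Prop)
    x y a b z w x' y' a' b' z' w' :
  twisted_config m x y a b z w x' y' a' b' z' w' ->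
  twisted_config m x y b a w z y' x' b' a' z' w'.
Proof.
case=> u u' h1 h2 h3 h4 h5 h6; split => //.
- by prove_uniq.
- by prove_uniq.
Qed.

Lemma twisted_config_converse (V V' : finType) (m : {set V} -> {set V'} -> Prop)
    x y a b z w x' y' a' b' z' w' :
  twisted_config m x y a b z w x' y' a' b' z' w' ->
  twisted_config (converse m) x' y' a' b' z' w' x y a b z w.
Proof.
case=> u u' h1 h2 h3 h4 h5 h6; split => //; first exact: corner_matched_converse.
by apply: corner_matchedC; exact: corner_matched_converse.
Qed.

Section TwistedConfig.
Variables (V V' : finType) (T : {set {set V}}) (T' : {set {set V'}}).
Variable (m : {set V} -> {set V'} -> Prop).
Hypotheses (sT : combinatorial_surface T) (sT' : combinatorial_surface T').
Hypothesis (mT : matching T T' m).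
Let mT' := matching_converse mT.

(** [twisted_step], applied on both sides of [xy] and to both surfaces, keeps the outer vertices
    apart from [a], [b], [a'] and [b']; intersection numbers then identify them in pairs. *)
Lemma twisted_config_exists x y a b x' y' a' b' : a != b ->
  corner_matched m x y a x' y' a' -> corner_matched m x y b y' x' b' ->
  exists z w z' w', twisted_config m x y a b z w x' y' a' b' z' w'.
Proof.
move=> ab ca cb.
have [t _ [z [z' [zy zy' p]]] [w [w' [wx wx' q]]]] := ca.
have [s _ [r [r' [ry rx' h]]] [u [u' [ux uy' k]]]] := cb.
have tC := matchedC t; have sC := matchedC s.
have t2 : matched m x y a y' x' a' by rewrite /matched [triple y' x' a']tripleC.
have s2 : matched m x y b x' y' b' by rewrite /matched [triple x' y' b']tripleC.
have tC2 := matchedC t2; have sC2 := matchedC s2.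
have ab' : a' != b'.
  have ut := matched_uniq sT mT t; have ut' := matched_uniq' sT' mT t.
  have us := matched_uniq sT mT s; have us' := matched_uniq' sT' mT s.
  by have := matched_count sT sT' mT t s2; break_uniqs; use_neq; case: eqVneq.
have ba : b != a by rewrite eq_sym.
have ba' : b' != a' by rewrite eq_sym.
have zb := twisted_step sT sT' mT t s2 p h ab zy ry zy' rx'.
have wb := twisted_step sT sT' mT tC sC2 q k ab wx ux wx' uy'.
have ra := twisted_step sT sT' mT s t2 h p ba ry zy rx' zy'.
have ua := twisted_step sT sT' mT sC tC2 k q ba ux wx uy' wx'.
have zb' := twisted_step sT' sT mT' t s2 p k ab' zy' uy' zy ux.
have wb' := twisted_step sT' sT mT' tC sC2 q h ab' wx' rx' wx ry.
have ra' := twisted_step sT' sT mT' s t2 h q ba' rx' wx' ry wx.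
have ua' := twisted_step sT' sT mT' sC tC2 k p ba' uy' zy' ux zy.
have ut := matched_uniq sT mT t; have ut' := matched_uniq' sT' mT t.
have us := matched_uniq sT mT s; have us' := matched_uniq' sT' mT s.
have up := matched_uniq sT mT p; have up' := matched_uniq' sT' mT p.
have uq := matched_uniq sT mT q; have uq' := matched_uniq' sT' mT q.
have uh := matched_uniq sT mT h; have uh' := matched_uniq' sT' mT h.
have uk := matched_uniq sT mT k; have uk' := matched_uniq' sT' mT k.
(* The images of [yaw] and [xbr] share [y'], so the triangles themselves meet, which is possible
   only through [r = w]; the next three equalities are alike. *)
have ru : r = w.
  by have := matched_count sT sT' mT q h; break_uniqs; use_neq; case: eqVneq => //;
      case: eqVneq.
have zu : u = z.
  by have := matched_count sT sT' mT p k; break_uniqs; use_neq; case: eqVneq => //;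
      case: eqVneq.
have ru' : r' = z'.
  by have := matched_count sT sT' mT p h; break_uniqs; use_neq; case: (eqVneq z' r') =>
      // _; case: (z == r).
have zu' : u' = w'.
  by have := matched_count sT sT' mT q k; break_uniqs; use_neq; case: (eqVneq w' u') =>
      // _; case: (w == u).
rewrite ru ru' zu zu' in h k uh uh' uk uk' ra ra' ua ua' *.
(* The images of [xaz] and [xbw] share only [z'], so the triangles share only [x]. *)
have zw : z != w.
  by have := matched_count sT sT' mT p h; break_uniqs; use_neq; case: eqVneq.
have zw' : z' != w'.
  by have := matched_count sT sT' mT p k; break_uniqs; use_neq; case: eqVneq.
by exists z, w, z', w'; split => //; prove_uniq.
Qed.

Lemma twisted_config_edge x y a b z w x' y' a' b' z' w' :
  twisted_config m x y a b z w x' y' a' b' z' w' ->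
  corner_matched m x a z x' a' z' \/ corner_matched m x a z a' x' z'.
Proof.
move=> [u u' ca _ p _ _ _].
have [d [d' [dy dy' c]]] := edge_cases sT sT' mT (corner_matchedCA ca).
have cd : matched m x a d x' a' d'.
  by case: c => -[k _ _ _] //; rewrite /matched [triple x' a' d']tripleC.
have ta : triple x a y \in T by rewrite tripleCA; case: ca => /(matched_in mT).
have zy : z != y by prove_uniq.
have dz := triangle_third sT ta (matched_in mT cd) (matched_in mT p) dy zy; subst d.
have := matching_fun sT sT' mT cd p => E.
have dz' : d' = z'.
  have : d' \in triple x' a' z' by rewrite -E in_triple eqxx !orbT.
  have uc := matched_uniq' sT' mT cd.
  by rewrite in_triple; break_uniqs; use_neq => /= /eqP.
by rewrite dz' in c.
Qed.

(** [twisted_config_exists] is applied to the edge [xa]: two of its outer triangles are already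
    known, which identifies the outer vertices with [b] and [w]; the other two are new. *)
Lemma twisted_config_twisted x y a b z w x' y' a' b' z' w' :
  twisted_config m x y a b z w x' y' a' b' z' w' -> corner_matched m x a z a' x' z' ->
  matched m x z w a' z' b' /\ matched m a z b x' z' w'.
Proof.
move=> [u u' ca cb p q r k] cz.
have yz : y != z by prove_uniq.
have [Z [W [Z' [W' [v v' _ _ p2 q2 r2 u2]]]]] := twisted_config_exists yz
    (corner_matchedCA ca) cz.
have t : matched m x y a x' y' a' by case: ca.
have s : matched m x y b x' y' b' by case: cb => h _ _ _;
    rewrite /matched [triple x' y' b']tripleC.
have Za : Z != a by prove_uniq.
have ba : b != a by prove_uniq.
have Zb := triangle_third sT (matched_in mT t) (matched_in mT p2) (matched_in mT s) Za
    ba; subst Z.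
have Wx : W != x by prove_uniq.
have wx : w != x by prove_uniq.
have tq : triple y a x \in T by rewrite tripleR (matched_in mT t).
have a2 : triple y a W \in T by rewrite tripleC (matched_in mT q2).
have Ww := triangle_third sT tq a2 (matched_in mT q) Wx wx; subst W.
have := matching_fun sT sT' mT p2 s => E1.
have := matching_fun sT sT' mT (matchedC q2) q => E2.
have Zb' : Z' = b'.
  have : Z' \in triple x' y' b' by rewrite -E1 in_triple eqxx !orbT.
  by rewrite in_triple; break_uniqs; use_neq => /= /eqP.
have Ww' : W' = w'.
  have : W' \in triple y' a' w' by rewrite -E2 in_triple eqxx !orbT.
  by rewrite in_triple; break_uniqs; use_neq => /= /eqP.
by rewrite Zb' Ww' in r2 u2.
Qed.

End TwistedConfig.

(** * Twisted edges *)

Section Exceptional.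
Variables (V V' : finType) (T : {set {set V}}) (T' : {set {set V'}}).
Variable (m : {set V} -> {set V'} -> Prop).
Hypotheses (sT : combinatorial_surface T) (sT' : combinatorial_surface T').
Hypothesis (mT : matching T T' m).

(** These five edges each lie in two triangles of the configuration, which leaves no third. *)
Lemma twisted_config_thirds x y a b z w x' y' a' b' z' w' c :
  twisted_config m x y a b z w x' y' a' b' z' w' ->
  [/\ triple x y c \in T -> (c == a) || (c == b),
      triple x a c \in T -> (c == y) || (c == z),
      triple y a c \in T -> (c == x) || (c == w),
      triple x b c \in T -> (c == y) || (c == w) &
      triple y b c \in T -> (c == x) || (c == z)].
Proof.
case=> u u' ca cb p q r k.
have t : matched m x y a x' y' a' by case: ca.
have s : matched m x y b y' x' b' by case: cb.
have tT := matched_in mT t; have sT2 := matched_in mT s.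
have th (v1 v2 v3 v4 : V) : triple v1 v2 v3 \in T -> triple v1 v2 v4 \in T -> v3 != v4 ->
    triple v1 v2 c \in T -> (c == v3) || (c == v4).
  move=> h3 h4 n h; have [//|/= c3] := eqVneq c v3; apply/eqP.
  by apply: (triangle_third sT h3 h h4 c3); rewrite eq_sym.
split.
- by apply: (th _ _ _ _ tT sT2); prove_uniq.
- by apply: (th _ _ _ _ _ (matched_in mT p)); [rewrite tripleCA|prove_uniq].
- by apply: (th _ _ _ _ _ (matched_in mT q)); [rewrite tripleR|prove_uniq].
- by apply: (th _ _ _ _ _ (matched_in mT r)); [rewrite tripleCA|prove_uniq].
- by apply: (th _ _ _ _ _ (matched_in mT k)); [rewrite tripleR|prove_uniq].
Qed.

End Exceptional.

Section Untwisted.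
Variables (V V' : finType) (T : {set {set V}}) (T' : {set {set V'}}).
Variable (m : {set V} -> {set V'} -> Prop).
Hypotheses (sT : combinatorial_surface T) (sT' : combinatorial_surface T').
Hypothesis (mT : matching T T' m).
Let mT' := matching_converse mT.

(** The triangle beyond [az] is compared with [ybz] and [xbw]: the intersection numbers allow only
    [w] opposite to [az]. Beyond [xz] all six known vertices are excluded, which yields a
    seventh. *)
Lemma twisted_config_untwisted x y a b z w x' y' a' b' z' w' :
  twisted_config m x y a b z w x' y' a' b' z' w' -> corner_matched m x a z x' a' z' ->
  matched m a z w a' z' w' /\ exists c c', [/\ matched m x z c x' z' c',
    uniq [:: x; y; a; b; z; w; c] & uniq [:: x'; y'; a'; b'; z'; w'; c']].
Proof.
move=> tw cz; have [u u' _ _ p q r k] := tw.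
have [_ _ [c [c' [ca ca' h]]] [d [d' [dx dx' l]]]] := cz.
have u1 := matched_uniq sT mT h; have u1' := matched_uniq' sT' mT h.
have u2 := matched_uniq sT mT l; have u2' := matched_uniq' sT' mT l.
split.
  have dy : d != y.
    apply/eqP => e; have [_ _ f _ _] := twisted_config_thirds sT mT z tw.
    have tz : triple y a z \in T by rewrite tripleC tripleCA -e (matched_in mT l).
    by have := f tz; prove_uniq.
  have dy' : d' != y'.
    apply/eqP => e.
    have [_ _ f _ _] := twisted_config_thirds sT' mT' z' (twisted_config_converse tw).
    have tz : triple y' a' z' \in T' by rewrite tripleC tripleCA -e (matched_in' mT l).
    by have := f tz; prove_uniq.
  have e1 := matched_count sT sT' mT l k; have e2 := matched_count sT sT' mT l r.
  have [dw dw'] : d = w /\ d' = w'.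
    move: e1 e2; break_uniqs; use_neq.
    by case: (eqVneq d b) => [->|db]; case: (eqVneq d w) => [?|dw];
      case: (eqVneq d' b') => [->|db']; case: (eqVneq d' w') => [?|dw']; use_neq.
  by rewrite dw dw' in l.
have [f _ _ g _] := twisted_config_thirds sT mT z tw.
have [f' _ _ g' _] := twisted_config_thirds sT' mT' z' (twisted_config_converse tw).
have cy : c != y.
  apply/eqP => e; have tz : triple x y z \in T by rewrite tripleCA -e (matched_in mT h).
  by have := f tz; prove_uniq.
have cb : c != b.
  apply/eqP => e; have tz : triple x b z \in T by rewrite tripleCA -e (matched_in mT h).
  by have := g tz; prove_uniq.
have cy' : c' != y'.
  apply/eqP => e; have tz : triple x' y' z' \in T' by rewrite tripleCA -e (matched_in'
      mT h).
  by have := f' tz; prove_uniq.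
have cb' : c' != b'.
  apply/eqP => e; have tz : triple x' b' z' \in T' by rewrite tripleCA -e (matched_in'
      mT h).
  by have := g' tz; prove_uniq.
have e1 := matched_count sT sT' mT h q; have e2 := matched_count sT sT' mT h r.
have [cw cw'] : c != w /\ c' != w'.
  move: e1 e2; break_uniqs; use_neq.
  by case: (eqVneq c w) => [?|cw]; case: (eqVneq c' w') => [?|cw']; use_neq.
by exists c, c'; split => //; prove_uniq.
Qed.

(** The edge [xz] must be twisted: otherwise the triangle beyond [xc] would be disjoint from [ybz]
    while their images share [x']. The twist produces triangles on [y'z'] and [x'w'], which have to
    be the ones already known there. *)
Lemma twisted_config_outer x y a b z w c e f x' y' a' b' z' w' c' e' f' :
  twisted_config m x y a b z w x' y' a' b' z' w' -> corner_matched m x a z x' a' z' ->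
  matched m a z w a' z' w' -> matched m b w z b' z' w' ->
  matched m x z c x' z' c' -> matched m x w e y' z' e' -> matched m y z f x' w' f' ->
  uniq [:: x; y; a; b; z; w; c] -> uniq [:: x'; y'; a'; b'; z'; w'; c'] ->
  e' != b' -> f' != b' ->
  matched m x w c y' z' c' /\ matched m y z c x' w' c'.
Proof.
move=> tw cz k1 l1 h r1 u1 uc uc' eb' fb'.
have [u u' ca _ p q r k] := tw.
have t : matched m x y a x' y' a' by case: ca.
have [d [d' [da da' cs]]] := edge_cases sT sT' mT (corner_matchedCA cz).
have cd : matched m x z d x' z' d'.
  by case: cs => -[g _ _ _] //; rewrite /matched [triple x' z' d']tripleC.
have ta : triple x z a \in T by rewrite tripleCA (matched_in mT p).
have ca0 : c != a by prove_uniq.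
have dc := triangle_third sT ta (matched_in mT cd) (matched_in mT h) da ca0; subst d.
have E := matching_fun sT sT' mT cd h.
have dc' : d' = c'.
  have : d' \in triple x' z' c' by rewrite -E in_triple eqxx !orbT.
  have ud := matched_uniq' sT' mT cd.
  by rewrite in_triple; break_uniqs; use_neq => /= /eqP.
subst d'.
have [f1 _ _ f4 _] := twisted_config_thirds sT mT c tw.
have [f1' _ _ f4' _] := twisted_config_thirds sT' mT' c' (twisted_config_converse tw).
case: cs => -[_ _ [g [g' [gz gz' ng]]] [i [i' [ix ix' ni]]]].
  have gy : g != y.
    apply/eqP => eg; have tc : triple x y c \in T by rewrite tripleCA -eg (matched_in
        mT ng).
    by have := f1 tc; prove_uniq.
  have gb : g != b.
    apply/eqP => eg; have tc : triple x b c \in T by rewrite tripleCA -eg (matched_in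
        mT ng).
    by have := f4 tc; prove_uniq.
  by have := matched_count sT sT' mT ng k; break_uniqs; use_neq.
(* Here [xz] is twisted: [xcg] goes to [z'c'g'] and [zci] to [x'c'i']. Meeting [xya] forces
   [g' = y'], and meeting [bwz] forces [i' = w']. *)
have ga' : g' != a'.
  apply/eqP => eg.
  have t1 : triple a' z' x' \in T' by rewrite tripleR (matched_in' mT p).
  have t2 : triple a' z' w' \in T' := matched_in' mT k1.
  have t3 : triple a' z' c' \in T'.
    by rewrite -tripleR -eg (matched_in' mT ng).
  have : w' = c' by apply: (third_eq sT' t1 t2 t3); prove_uniq.
  by move/eqP; prove_uniq.
have gy' : g' = y'.
  have := matched_count sT sT' mT ng t; break_uniqs; use_neq.
  by case: (eqVneq g' y').
have ib' : i' != b'.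
  apply/eqP => ei; have tc : triple x' b' c' \in T' by rewrite tripleCA -ei
      (matched_in' mT ni).
  by have := f4' tc; prove_uniq.
have iw' : i' = w'.
  have := matched_count sT sT' mT ni l1; break_uniqs; use_neq.
  by case: (eqVneq i' w').
subst g' i'.
have ec' : c' = e'.
  have t1 : triple y' z' b' \in T' by rewrite tripleCA (matched_in' mT r).
  have t2 : triple y' z' c' \in T' by rewrite -tripleR (matched_in' mT ng).
  by apply: (third_eq sT' t1 t2 (matched_in' mT r1)); [prove_uniq|rewrite eq_sym].
have fc' : c' = f'.
  have t1 : triple x' w' b' \in T' by rewrite tripleCA (matched_in' mT k).
  have t2 : triple x' w' c' \in T' by rewrite tripleCA (matched_in' mT ni).
  by apply: (third_eq sT' t1 t2 (matched_in' mT u1)); [prove_uniq|rewrite eq_sym].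
subst e' f'; split.
  have ng2 : m (triple x c g) (triple y' z' c') by rewrite -[triple y' z' c']tripleR;
      exact: ng.
  have E1 := matching_inj sT sT' mT r1 ng2.
  have : c \in triple x w e by rewrite E1 in_triple eqxx orbT.
  by rewrite in_triple; break_uniqs; use_neq => /= /eqP ->.
have ni2 : m (triple z c i) (triple x' w' c') by rewrite [triple x' w' c']tripleCA;
    exact: ni.
have E1 := matching_inj sT sT' mT u1 ni2.
have : c \in triple y z f by rewrite E1 in_triple eqxx orbT.
by rewrite in_triple; break_uniqs; use_neq => /= /eqP ->.
Qed.

End Untwisted.

(** * Recognition of a surface from an explicit list of triangles *)

Section ClosedTriangulations.
Implicit Types (L : seq (nat * nat * nat)).

Definition listed L (i j k : nat) := has (fun p => perm_eq [:: i; j; k] p)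
  [seq [:: p.1.1; p.1.2; p.2] | p <- L].

(* Every edge of a listed triangle lies in a second one, so that a connected
   surface containing the listed triangles has no others. *)
Definition closed_list n L :=
  all (fun p => [&& p.1.1 < n, p.1.2 < n & p.2 < n]%N) L &&
  all (fun i => all (fun j => all (fun k =>
    listed L i j k ==> has (fun d => (d != k) && listed L i j d) (iota 0 n))
      (iota 0 n)) (iota 0 n)) (iota 0 n).

Variables (V : finType) (T : {set {set V}}).
Hypothesis (sT : combinatorial_surface T).

Lemma listed_perm L i j k i' j' k' : perm_eq [:: i; j; k] [:: i'; j'; k'] ->
  listed L i j k = listed L i' j' k'.
Proof.
by move=> h; apply: eq_has => p /=; apply/idP/idP; apply: perm_trans; rewrite // perm_sym.
Qed.

Lemma listed_bound n L i j k : closed_list n L -> listed L i j k -> [/\ i < n,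
    j < n & k < n]%N.
Proof.
case/andP => /allP h _ /hasP[_ /mapP[p /h /and3P[h1 h2 h3] ->] /perm_mem e].
have b q : q \in [:: p.1.1; p.1.2; p.2] -> (q < n)%N by rewrite !inE => /or3P[]/eqP->.
by split; apply: b; rewrite -e !inE eqxx ?orbT.
Qed.

Lemma listed_other n L i j k : closed_list n L -> listed L i j k ->
  exists2 d, d != k & listed L i j d.
Proof.
move=> cl h; have [i_n jn kn] := listed_bound cl h.
case/andP: cl => _ /allP/(_ i) + ; rewrite mem_iota => /(_ i_n) /allP/(_ j).
rewrite mem_iota => /(_ jn) /allP/(_ k); rewrite mem_iota => /(_ kn) /implyP/(_ h).
by case/hasP => d _ /andP[]; exists d.
Qed.

Definition listed_triangles (x0 : V) (e : seq V) L :=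
  forall i j k, listed L i j k -> triple (nth x0 e i) (nth x0 e j) (nth x0 e k) \in T.

(** Being listed passes to adjacent triangles, because the second listed triangle on an edge is the
    only other one there by [triangle_third]; connectedness then reaches all of [T]. *)
Lemma closed_list_triangles x0 e L : uniq e -> closed_list (size e) L -> L != [::] ->
  listed_triangles x0 e L ->
  forall t, t \in T -> exists i j k, listed L i j k /\ t = triple (nth x0 e i) (nth x0
      e j) (nth x0 e k).
Proof.
move=> ue cl L0 LT.
have [[[i0 j0] k0] pL] : exists p, p \in L by case: (L) L0 => // p *; exists p;
    rewrite inE eqxx.
have l0 : listed L i0 j0 k0.
  by apply/hasP; exists [:: i0; j0; k0] => //; apply/mapP; exists (i0, j0, k0).
pose P t := exists i j k, listed L i j k /\ t = triple (nth x0 e i) (nth x0 e j) (nth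
    x0 e k).
move=> t tT; apply: (surface_connected sT (P := P) _ (LT _ _ _ l0) tT); last first.
  by exists i0, j0, k0.
move=> x y z d h1 h2 [i [j [k [l E]]]].
have [i_n jn kn] := listed_bound cl l.
have [i' [j' [k' [pe ex ey ez]]]] : exists i' j' k', [/\ perm_eq [:: i; j; k] [:: i';
    j'; k'],
    x = nth x0 e i', y = nth x0 e j' & z = nth x0 e k'].
  have u := triangle_uniq sT h1.
  have vx : x \in triple x y z by rewrite in_triple eqxx.
  have vy : y \in triple x y z by rewrite in_triple eqxx orbT.
  have vz : z \in triple x y z by rewrite in_triple eqxx !orbT.
  rewrite E !in_triple in vx vy vz.
  case/or3P: vx => /eqP vx; case/or3P: vy => /eqP vy; case/or3P: vz => /eqP vz;
    move: u; rewrite vx vy vz /= !inE ?eqxx ?orbT /= ?andbF // => _.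
  - by exists i, j, k; split.
  - by exists i, k, j; split => //; apply/permP => p /=;
      move: (p i : nat) (p j : nat) (p k : nat); clear; lia.
  - by exists j, i, k; split => //; apply/permP => p /=;
      move: (p i : nat) (p j : nat) (p k : nat); clear; lia.
  - by exists j, k, i; split => //; apply/permP => p /=;
      move: (p i : nat) (p j : nat) (p k : nat); clear; lia.
  - by exists k, i, j; split => //; apply/permP => p /=;
      move: (p i : nat) (p j : nat) (p k : nat); clear; lia.
  - by exists k, j, i; split => //; apply/permP => p /=;
      move: (p i : nat) (p j : nat) (p k : nat); clear; lia.
rewrite (listed_perm _ pe) in l.
have [d' d'k l'] := listed_other cl l.
have [_ _ d'n] := listed_bound cl l'.
have [_ _ kn'] := listed_bound cl l.
have [->|dz] := eqVneq d z; first by exists i', j', k'; rewrite ex ey ez.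
have h3 := LT _ _ _ l'; rewrite -ex -ey in h3.
have n3 : nth x0 e d' != z by rewrite ez nth_uniq.
by exists i', j', d'; split => //; rewrite -ex -ey (triangle_third sT h1 h2 h3 dz n3).
Qed.

Lemma closed_list_vertices x0 e L : uniq e -> closed_list (size e) L -> L != [::] ->
  listed_triangles x0 e L -> forall v, v \in e.
Proof.
move=> ue cl L0 LT v; have [y [z h]] := vertex_in_triangle sT v.
have [i [j [k [l E]]]] := closed_list_triangles ue cl L0 LT h.
have : v \in triple v y z by rewrite in_triple eqxx.
have [i_n jn kn] := listed_bound cl l.
by rewrite E in_triple => /or3P[]/eqP->; rewrite mem_nth.
Qed.

End ClosedTriangulations.

Definition same_triangulation (V V' : finType) (T : {set {set V}}) (T' : {set {set
    V'}}) :=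
  exists phi : V -> V', bijective phi /\
    forall t : {set V}, (t \in T) = ((phi @: t)%SET \in T').

Lemma imset_triple (V V' : finType) (phi : V -> V') x y z :
  (phi @: triple x y z)%SET = triple (phi x) (phi y) (phi z).
Proof. by rewrite /triple !imsetU !imset_set1. Qed.

Lemma same_triangulation_by_maps (V V' : finType) (T : {set {set V}}) (T' : {set {set
    V'}})
    (phi : V -> V') (psi : V' -> V) : cancel phi psi -> cancel psi phi ->
  (forall t, t \in T -> (phi @: t)%SET \in T') -> (forall t, t \in T' ->
      (psi @: t)%SET \in T) ->
  same_triangulation T T'.
Proof.
move=> K K' f g; exists phi; split; first by exists psi.
move=> t; apply/idP/idP; first exact: f.
move/g; rewrite -imset_comp (_ : ((psi \o phi) @: t)%SET = t) //.
by rewrite (eq_imset _ (g := id)) ?imset_id.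
Qed.

Lemma same_triangulation_by_lists (V V' : finType) (T : {set {set V}}) (T' : {set {set
    V'}})
    x0 (e : seq V) x0' (e' : seq V') L :
  combinatorial_surface T -> combinatorial_surface T' ->
  uniq e -> uniq e' -> size e = size e' -> closed_list (size e) L -> L != [::] ->
  listed_triangles T x0 e L -> listed_triangles T' x0' e' L -> same_triangulation T T'.
Proof.
move=> sT sT' ue ue' se cl L0 LT LT'.
have cl' := cl; rewrite se in cl'.
have ve := closed_list_vertices sT ue cl L0 LT.
have ve' := closed_list_vertices sT' ue' cl' L0 LT'.
apply: (@same_triangulation_by_maps _ _ T T' (fun v => nth x0' e' (index v e))
  (fun v => nth x0 e (index v e'))).
- by move=> v; rewrite index_uniq ?nth_index // -se index_mem.
- by move=> v; rewrite index_uniq ?nth_index // se index_mem.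
- move=> t /(closed_list_triangles sT ue cl L0 LT)[i [j [k [l ->]]]].
  have [i_n jn kn] := listed_bound cl l.
  by rewrite imset_triple !index_uniq //; exact: LT'.
- move=> t /(closed_list_triangles sT' ue' cl' L0 LT')[i [j [k [l ->]]]].
  have [i_n jn kn] := listed_bound cl' l.
  by rewrite imset_triple !index_uniq //; exact: LT.
Qed.

Lemma listed_triangles_all (V : finType) (T : {set {set V}}) x0 (e : seq V) L :
  all (fun p => triple (nth x0 e p.1.1) (nth x0 e p.1.2) (nth x0 e p.2) \in T) L ->
  listed_triangles T x0 e L.
Proof.
move=> /allP h i j k /hasP[_ /mapP[p /h pT ->]] /(perm_map (nth x0 e))/perm_mem E.
rewrite (_ : triple _ _ _ = triple (nth x0 e p.1.1) (nth x0 e p.1.2) (nth x0 e p.2)) //.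
by apply/finset.setP => v; have := E v; rewrite !in_triple /= !inE.
Qed.

(* The six-vertex triangulation of the projective plane: all its triangles meet,
   so that its intersection matrix has more symmetries than the surface. *)
Definition projective_plane6 : seq (nat * nat * nat) :=
  [:: (0, 1, 2); (0, 1, 3); (0, 2, 4); (1, 2, 5); (0, 3, 5); (1, 3, 4);
      (0, 4, 5); (2, 4, 3); (1, 5, 4); (2, 5, 3)].

(* The projective plane obtained by coning off the three quadrilaterals of the
   hemicube; 2, 3 and 6 are the apices of the cones. *)
Definition projective_plane7 : seq (nat * nat * nat) :=
  [:: (0, 1, 2); (0, 1, 3); (0, 2, 4); (1, 2, 5); (0, 3, 5); (1, 3, 4);
      (2, 4, 5); (3, 5, 4); (0, 4, 6); (0, 5, 6); (1, 4, 6); (1, 5, 6)].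

(** * Surfaces with a twisted edge *)

Section Main.
Variables (V V' : finType) (T : {set {set V}}) (T' : {set {set V'}}).
Variable (m : {set V} -> {set V'} -> Prop).
Hypotheses (sT : combinatorial_surface T) (sT' : combinatorial_surface T').
Hypothesis (mT : matching T T' m).
Let mT' := matching_converse mT.

(** If [xa] is twisted then so is [ya]: otherwise [az] would lie in three triangles, with third
    vertices [x], [b] and [w]. The two twists add four triangles to the six of the configuration. *)
Lemma same_triangulation_plane6 x y a b z w x' y' a' b' z' w' :
  twisted_config m x y a b z w x' y' a' b' z' w' -> corner_matched m x a z a' x' z' ->
  same_triangulation T T'.
Proof.
move=> tw cz; have [u u' ca cb p q r k] := tw.
have t : matched m x y a x' y' a' by case: ca.
have s : matched m x y b y' x' b' by case: cb.
have [p1 p2] := twisted_config_twisted sT sT' mT tw cz.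
have twC := twisted_configC tw.
case: (twisted_config_edge sT sT' mT twC) => cw.
  have [k1 _] := twisted_config_untwisted sT sT' mT twC cw.
  have t1 : triple a z x \in T by rewrite tripleR (matched_in mT p).
  have t3 : triple a z w \in T by rewrite tripleCA (matched_in mT k1).
  have : b = w by apply: (third_eq sT t1 (matched_in mT p2) t3); prove_uniq.
  by move/eqP; prove_uniq.
have [q1 q2] := twisted_config_twisted sT sT' mT twC cw.
(* Equal positions in the two labellings need not be matched by [m]: [xbw] goes to [y'b'z'], while
   the triangle in its position is [x'b'w']. *)
apply: (@same_triangulation_by_lists _ _ T T' x [:: x; y; a; b; z; w] x' [:: x'; y';
    a'; b'; z'; w']
  projective_plane6) => //; apply: listed_triangles_all; rewrite /= ?andbT.
  rewrite (matched_in mT t) (matched_in mT s) (matched_in mT p) (matched_in mT q)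
      (matched_in mT r).
  by rewrite (matched_in mT k) (matched_in mT p1) (matched_in mT p2) (matched_in mT q1)
      (matched_in mT q2).
rewrite (matched_in' mT t) [triple x' y' b']tripleC (matched_in' mT s) (matched_in' mT
    p) (matched_in' mT q).
rewrite (matched_in' mT k) (matched_in' mT r) (matched_in' mT p2).
rewrite (matched_in' mT p1) (matched_in' mT q2).
by rewrite (matched_in' mT q1).
Qed.

(** The symmetries of the configuration bring each of [xa], [ya], [xb], [yb] into the place of [xa].
    If none is twisted, the seventh vertices found from the four edges coincide, and twelve
    triangles on seven vertices are forced. *)
Lemma same_triangulation_twisted x y a b x' y' a' b' : a != b ->
  corner_matched m x y a x' y' a' -> corner_matched m x y b y' x' b' ->
      same_triangulation T T'.
Proof.
move=> ab ca cb.
have [z [w [z' [w' tw]]]] := twisted_config_exists sT sT' mT ab ca cb.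
have twC := twisted_configC tw.
have twS := twisted_config_swap tw.
have twSC := twisted_configC twS.
case: (twisted_config_edge sT sT' mT tw) => [c1|]; last exact:
    (same_triangulation_plane6 tw).
case: (twisted_config_edge sT sT' mT twC) => [c2|];
    last exact: (same_triangulation_plane6 twC).
case: (twisted_config_edge sT sT' mT twS) => [c3|];
    last exact: (same_triangulation_plane6 twS).
case: (twisted_config_edge sT sT' mT twSC) => [c4|];
    last exact: (same_triangulation_plane6 twSC).
have [k1 [c [c' [h1 u1 u1']]]] := twisted_config_untwisted sT sT' mT tw c1.
have [_ [d [d' [h2 u2 u2']]]] := twisted_config_untwisted sT sT' mT twC c2.
have [k3 [e [e' [h3 u3 u3']]]] := twisted_config_untwisted sT sT' mT twS c3.
have [_ [f [f' [h4 u4 u4']]]] := twisted_config_untwisted sT sT' mT twSC c4.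
have eb' : e' != b' by prove_uniq.
have fb' : f' != b' by prove_uniq.
have [ o1 o2] := twisted_config_outer sT sT' mT tw c1 k1 k3 h1 h3 h4 u1 u1' eb' fb'.
have [k2 _] := twisted_config_untwisted sT sT' mT twC c2.
have [k4 _] := twisted_config_untwisted sT sT' mT twSC c4.
have [ o3 o4] := twisted_config_outer sT sT' mT twC c2 k2 k4 h2 h4 h3 u2 u2' fb' eb'.
have [_ _ _ _ p q r k] := tw.
have t : matched m x y a x' y' a' by case: ca.
have s : matched m x y b y' x' b' by case: cb.
have dc : d = c.
  have t1 : triple y z b \in T by rewrite tripleCA (matched_in mT k).
  by apply: (third_eq sT t1 (matched_in mT o3) (matched_in mT o2)); prove_uniq.
have dc' : d' = c'.
  have t1 : triple x' w' b' \in T' by rewrite tripleCA (matched_in' mT k).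
  by apply: (third_eq sT' t1 (matched_in' mT o3) (matched_in' mT o2)); prove_uniq.
rewrite dc dc' in h2.
apply: (@same_triangulation_by_lists _ _ T T' x [:: x; y; a; b; z; w; c] x' [:: x'; y';
    a'; b'; z'; w'; c']
  projective_plane7) => //; apply: listed_triangles_all; rewrite /= ?andbT.
  rewrite (matched_in mT t) (matched_in mT s) (matched_in mT p) (matched_in mT q)
      (matched_in mT r).
  rewrite (matched_in mT k) (matched_in mT k1) (matched_in mT k3) (matched_in mT h1)
      (matched_in mT o1).
  by rewrite (matched_in mT o2) (matched_in mT h2).
rewrite (matched_in' mT t) [triple x' y' b']tripleC (matched_in' mT s) (matched_in' mT
    p) (matched_in' mT q).
rewrite (matched_in' mT k) (matched_in' mT r) (matched_in' mT k1) [triple b' w'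
    z']tripleCA (matched_in' mT k3).
by rewrite (matched_in' mT h1) (matched_in' mT o2) (matched_in' mT o1) (matched_in' mT
    h2).
Qed.

End Main.

(** * Gluing the corner maps when no edge is twisted *)

Section Untwisted.
Variables (V V' : finType) (T : {set {set V}}) (T' : {set {set V'}}).
Variable (m : {set V} -> {set V'} -> Prop).
Hypotheses (sT : combinatorial_surface T) (sT' : combinatorial_surface T').
Hypothesis (mT : matching T T' m).
Hypothesis untwisted : forall x y a b x' y' a' b', a != b ->
  corner_matched m x y a x' y' a' -> corner_matched m x y b y' x' b' -> False.

Definition vertex_matched x x' := exists y z y' z', corner_matched m x y z x' y' z'.

Lemma triple_eq2 (W : finType) (x y z u v : W) : uniq [:: x; y; z] ->
  triple x y z = triple x u v -> (y = u /\ z = v) \/ (y = v /\ z = u).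
Proof.
move=> U E.
have h1 : y \in triple x u v by rewrite -E in_triple eqxx orbT.
have h2 : z \in triple x u v by rewrite -E in_triple eqxx !orbT.
rewrite !in_triple in h1 h2; clear E.
by break_uniqs; elim_eqs; auto.
Qed.

Lemma vertex_matched_exists x : exists x', vertex_matched x x'.
Proof.
have [y [z h]] := vertex_in_triangle sT x.
have [x' [y' [z' c]]] := corner_exists sT sT' mT h.
by exists x', y, z, y', z'.
Qed.

(** The image of [x] is carried from triangle to triangle around its star: by [edge_cases] the next
    corners keep or swap the ends of the common edge, and [untwisted] excludes the swap. *)
Lemma vertex_matched_star x x' y z : vertex_matched x x' -> triple x y z \in T ->
  exists y' z', corner_matched m x y z x' y' z'.
Proof.
move=> [y0 [z0 [y0' [z0' c0]]]] h.
pose P t := forall y z, t = triple x y z -> exists y' z', corner_matched m x y z x' y' z'.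
have h0 : triple x y0 z0 \in T by case: c0 => /(matched_in mT).
suff : P (triple x y z) by apply.
apply: (star_connected sT (P := P) _ h0 h); last first.
  move=> y1 z1 E; have u := triangle_uniq sT h0.
  case: (triple_eq2 u E) => -[<- <-]; first by exists y0', z0'.
  by exists z0', y0'; exact: corner_matchedCA.
move=> y1 z1 d h1 h2 Pt y2 z2 E.
have [dz|dz] := eqVneq d z1; first by apply: Pt; rewrite -E dz.
have [y' [z' c]] := Pt y1 z1 erefl.
have [b [b' [bz bz' cb]]] := edge_cases sT sT' mT c.
have hb : triple x y1 b \in T by case: cb => -[/(matched_in mT)].
have db : d = b by exact: (triangle_third sT h1 h2 hb dz bz).
subst d; case: cb => cb; last first.
  by have := untwisted _ c cb; rewrite eq_sym => /(_ bz).
have u := triangle_uniq sT hb.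
case: (triple_eq2 u E) => -[<- <-]; first by exists y', b'.
by exists b', y'; exact: corner_matchedCA.
Qed.

Lemma vertex_matched_fun x x' x'' : vertex_matched x x' -> vertex_matched x x'' ->
    x' = x''.
Proof.
move=> h [y [z [y' [z' c]]]].
have hT : triple x y z \in T by case: c => /(matched_in mT).
have [u [v c2]] := vertex_matched_star h hT.
exact: (corner_fun sT sT' mT c2 c).
Qed.

End Untwisted.

Lemma vertex_matched_converse (V V' : finType) (m : {set V} -> {set V'} -> Prop) x x' :
  vertex_matched m x x' -> vertex_matched (converse m) x' x.
Proof. by case=> y [z [y' [z' /corner_matched_converse c]]]; exists y', z', y, z. Qed.

Lemma same_triangulation_untwisted (V V' : finType) (T : {set {set V}}) (T' : {set {set
    V'}})
    (m : {set V} -> {set V'} -> Prop) :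
  combinatorial_surface T -> combinatorial_surface T' -> matching T T' m ->
  (forall x y a b x' y' a' b', a != b ->
    corner_matched m x y a x' y' a' -> corner_matched m x y b y' x' b' -> False) ->
  same_triangulation T T'.
Proof.
move=> sT sT' mT nt; have mT' := matching_converse mT.
(* Twists are symmetric in the two surfaces, so the converse matching has none either. *)
have nt' x y a b x' y' a' b' : a != b -> corner_matched (converse m) x y a x' y' a' ->
    corner_matched (converse m) x y b y' x' b' -> False.
  move=> ab /corner_matched_converse c1 /corner_matched_converse c2.
  have ab' : a' != b'.
    apply: contraNneq ab => e; rewrite -e in c2.
    have t1 : matched m x' y' a' x y a by case: c1.
    have t2 : matched m y' x' a' x y b by case: c2.
    have t3 : matched m x' y' a' x y b by rewrite /matched tripleC.
    have E := matching_fun sT sT' mT t1 t3.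
    have : a \in triple x y b by rewrite -E in_triple eqxx !orbT.
    have u := matched_uniq' sT' mT t1.
    by rewrite in_triple; break_uniqs; use_neq.
  exact: (nt _ _ _ _ _ _ _ _ ab' c1 (corner_matchedC c2)).
pose phi x := projT1 (cid (vertex_matched_exists sT sT' mT x)).
have phiP x : vertex_matched m x (phi x) := projT2 (cid (vertex_matched_exists sT sT'
    mT x)).
pose psi x := projT1 (cid (vertex_matched_exists sT' sT mT' x)).
have psiP x : vertex_matched (converse m) x (psi x) :=
    projT2 (cid (vertex_matched_exists sT' sT mT' x)).
apply: (same_triangulation_by_maps (phi := phi) (psi := psi)).
- move=> x; apply: (vertex_matched_fun sT' sT mT' nt' (psiP _)).
  exact: vertex_matched_converse.
- move=> x; apply: (vertex_matched_fun sT sT' mT nt (phiP _)).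
  exact: (vertex_matched_converse (psiP x)).
- move=> t tT; have [x [y [z E]]] := card3_triple (triangle_card sT tT).
  rewrite E in tT *; have [x' [y' [z' c]]] := corner_exists sT sT' mT tT.
  have ex : phi x = x'.
    by apply: (vertex_matched_fun sT sT' mT nt (phiP _)); exists y, z, y', z'.
  have ey : phi y = y'.
    by apply: (vertex_matched_fun sT sT' mT nt (phiP _)); exists x, z, x', z';
        exact: corner_matchedC.
  have ez : phi z = z'.
    apply: (vertex_matched_fun sT sT' mT nt (phiP _)); exists x, y, x', y'.
    by apply: corner_matchedC; exact: corner_matchedCA.
  by rewrite imset_triple ex ey ez; case: c => /(matched_in' mT).
- move=> t tT; have [x [y [z E]]] := card3_triple (triangle_card sT' tT).
  rewrite E in tT *; have [x' [y' [z' c]]] := corner_exists sT' sT mT' tT.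
  have ex : psi x = x'.
    by apply: (vertex_matched_fun sT' sT mT' nt' (psiP _)); exists y, z, y', z'.
  have ey : psi y = y'.
    by apply: (vertex_matched_fun sT' sT mT' nt' (psiP _)); exists x, z, x', z';
        exact: corner_matchedC.
  have ez : psi z = z'.
    apply: (vertex_matched_fun sT' sT mT' nt' (psiP _)); exists x, y, x', y'.
    by apply: corner_matchedC; exact: corner_matchedCA.
  by rewrite imset_triple ex ey ez; case: c => /(matched_in' mT').
Qed.

Lemma intersection_matrix_determines (V V' : finType) (T : {set {set V}}) (T' : {set
    {set V'}})
    (m : {set V} -> {set V'} -> Prop) :
  combinatorial_surface T -> combinatorial_surface T' -> matching T T' m ->
      same_triangulation T T'.
Proof.
move=> sT sT' mT.
have [[x [y [a [b [x' [y' [a' [b' [ab ca cb]]]]]]]]]|nt] :=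
  pselect (exists x y a b x' y' a' b', [/\ a != b, corner_matched m x y a x' y' a' &
    corner_matched m x y b y' x' b']).
  exact: (same_triangulation_twisted sT sT' mT ab ca cb).
apply: (same_triangulation_untwisted sT sT' mT) => x y a b x' y' a' b' ab ca cb.
by apply: nt; exists x, y, a, b, x', y', a', b'.
Qed.

(** * Reconstruction *)

Section Bridge.
Import numFieldNormedType.Exports.
Local Open Scope classical_set_scope.
Variables (R : realType) (V : finType) (K : simplicial_complex V).
Hypothesis hK : triangulated_surface R K.

Let hX : locally_euclidean R 2 (realization R K).
Proof. by case: hK => -[]. Qed.

Let T := triangles K.

Lemma tripleE x y z : triple x y z \in T = (uniq [:: x; y;
    z] && (triple x y z \in faces K)).
Proof.
rewrite /T /triangles inE andbC; congr (_ && _).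
by apply/eqP/idP => /card_triple.
Qed.

Lemma face_edge x y z : triple x y z \in T -> x != y /\ [set x; y]%SET \in faces K.
Proof.
rewrite tripleE => /andP[u h]; split; first by break_uniqs.
apply: (faces_sub h); first by apply: finset.subsetUl.
by apply/set0Pn; exists x; rewrite !inE eqxx.
Qed.

Lemma edge_triangles x y : x != y -> [set x; y]%SET \in faces K ->
  exists c d, [/\ c != d, triple x y c \in T & triple x y d \in T].
Proof.
move=> xy /(edge_in_two_triangles hX xy)[c [d [cd hc hd fc fd]]].
have E v : triple x y v = (v |: [set x; y])%SET by rewrite /triple finset.setUC.
exists c, d; rewrite !tripleE !E fc fd !andbT; split => //.
  by move: hc; rewrite !inE !negb_or => /andP[? ?]; prove_uniq.
by move: hd; rewrite !inE !negb_or => /andP[? ?]; prove_uniq.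
Qed.

(** Faces have at most three vertices, and vertices and edges extend to triangles, so the complex is
    recovered from its triangles and an isomorphism only has to respect these. *)
Lemma face_in_triangle (s : {set V}) :
  (s \in faces K) = (s != finset.set0) && [exists t in T, s \subset t].
Proof.
apply/idP/andP => [sF|[s0 /existsP[t /andP[tT st]]]]; last first.
  by move: tT; rewrite inE => /andP[tF _]; exact: (faces_sub tF).
have s0 : s != finset.set0 by apply: contraNneq (faces_neq0 K) => <-.
split => //.
have edge x y : x != y -> [set x; y]%SET \in faces K -> exists2 t, t \in T & [set x;
    y]%SET \subset t.
  move=> xy xyF; have [c [d [_ h _]]] := edge_triangles xy xyF.
  by exists (triple x y c) => //; exact: finset.subsetUl.
have toexists : (exists2 t, t \in T & s \subset t) -> [exists t in T, s \subset t].
  by case=> t tT st; apply/existsP; exists t; rewrite tT.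
apply: toexists.
have := face_card hX sF; rewrite leq_eqVlt => /orP[s3|].
  by exists s => //; rewrite inE sF.
rewrite ltnS leq_eqVlt => /orP[/cards2P[x [y [xy E]]]|].
  by rewrite E in sF *; exact: edge.
rewrite ltnS leq_eqVlt => /orP[/cards1P[x E]|]; last by rewrite ltnS leqn0 cards_eq0
    (negbTE s0).
have [y yx xyF] := vertex_in_edge hX x.
have [|t tT st] := edge x y _ xyF; first by rewrite eq_sym.
by exists t => //; apply: fintype.subset_trans st; rewrite E; exact: finset.subsetUl.
Qed.

Lemma surface_combinatorial : combinatorial_surface T.
Proof.
have star x (P : {set V} -> Prop) :
    (forall y z d, triple x y z \in T -> triple x y d \in T -> P (triple x y z) ->
        P (triple x y d)) ->
    forall y z y' z', triple x y z \in T -> triple x y' z' \in T -> P (triple x y z) ->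
        P (triple x y' z').
  move=> cl y z y' z' h h' Ph.
  (* [A] consists of the link vertices reached by triangles satisfying [P]; [link_connected] yields
     a triangle leaving [A], to which [P] nevertheless propagates. *)
  pose A : {set V} := [set w | `[< exists u, triple x w u \in T /\ P (triple x w u)
      >]]%SET.
  have inA w : reflect (exists u, triple x w u \in T /\ P (triple x w u)) (w \in A).
    by rewrite inE; exact: asboolP.
  have yA : y \in A by apply/inA; exists z.
  have [/inA[u [hu Pu]]|y'A] := boolP (y' \in A); first exact: (cl _ _ _ hu h').
  have [xy xyF] := face_edge h; have [xy' xyF'] := face_edge h'.
  rewrite eq_sym in xy; rewrite eq_sym in xy'.
  have [p [q [/inA[u [hu Pu]] qA px qx pqF]]] := link_connected hX xy xy' yA y'A xyF xyF'.
  have hpq : triple x p q \in T.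
    rewrite tripleE pqF andbT; have pq : p != q by apply: contraNneq qA => <-;
        apply/inA; exists u.
    by prove_uniq.
  have Ppq := cl _ _ _ hu hpq Pu.
  by case/negP: qA; apply/inA; exists p; rewrite tripleCA.
split => //.
- by move=> t; rewrite inE => /andP[_ /eqP].
- move=> x y z /face_edge[xy xyF]; have [c [d [cd hc hd]]] := edge_triangles xy xyF.
  have [cz|cz] := eqVneq c z; last by exists c.
  by exists d => //; rewrite eq_sym -cz.
- move=> x y z d e; rewrite !tripleE => /andP[u1 h1] /andP[u2 h2] /andP[u3 h3] dz ez.
  apply/eqP; apply: contraT => de.
  have U : uniq [:: x; y; z; d; e] by prove_uniq.
  by have := edge_in_at_most_two_triangles hX U h1 h2; rewrite h3.
- move=> P cl t t' tT t'T.
  have [x [y [z E]]] : exists x y z, t = triple x y z.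
    by apply: card3_triple; move: tT; rewrite inE => /andP[_ /eqP].
  have [x' [y' [z' E']]] : exists x y z, t' = triple x y z.
    by apply: card3_triple; move: t'T; rewrite inE => /andP[_ /eqP].
  rewrite {}E {}E' in tT t'T * => Pt.
  (* The same argument for vertices: [P] spreads over the star of [p], hence to a triangle on the
     edge [pq] that leaves [A]. *)
  pose A : {set V} := [set v | `[< exists y z, triple v y z \in T /\ P (triple v y z)
      >]]%SET.
  have inA v : reflect (exists y z, triple v y z \in T /\ P (triple v y z)) (v \in A).
    by rewrite inE; exact: asboolP.
  have xA : x \in A by apply/inA; exists y, z.
  have [/inA[u [v [h Ph]]]|x'A] := boolP (x' \in A);
      first exact: (star _ _ (cl x') _ _ _ _ h t'T Ph).
  have cX : connected [set: realization R K] by case: hK.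
  have [p [q [/inA[u [v [h Ph]]] qA pqF]]] := realization_connected cX xA x'A.
  have pq : p != q by apply: contraNneq qA => <-; apply/inA; exists u, v.
  have [c [_ [_ hc _]]] := edge_triangles pq pqF.
  have Pc := star _ _ (cl p) _ _ _ _ h hc Ph.
  by case/negP: qA; apply/inA; exists p, c; rewrite tripleC.
- move=> x; have [y yx xyF] := vertex_in_edge hX x.
  have [|c [d [_ h _]]] := edge_triangles _ xyF; first by rewrite eq_sym.
  by exists y, c.
Qed.

End Bridge.

Lemma same_triangulation_isomorphic (R : realType) (V V' : finType) (S :
    simplicial_complex V)
    (S' : simplicial_complex V') : triangulated_surface R S ->
        triangulated_surface R S' ->
  same_triangulation (triangles S) (triangles S') -> isomorphic S S'.
Proof.
move=> hS hS' [phi [phib tphi]]; exists phi; split => // s.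
rewrite (face_in_triangle hS) (face_in_triangle hS'); congr (_ && _).
  by rewrite -!cards_eq0 card_imset //; exact: bij_inj.
have [psi K1 K2] := phib.
apply/existsP/existsP => -[t /andP[tT st]].
  by exists (phi @: t)%SET; rewrite -tphi tT imsetS.
have E : (phi @: (psi @: t))%SET = t.
  by rewrite -imset_comp (eq_imset _ (g := id)) ?imset_id.
exists (psi @: t)%SET; rewrite tphi E tT /=.
apply/fintype.subsetP => v vs; rewrite -[v]K1; apply: imset_f.
by apply: (fintype.subsetP st); exact: imset_f.
Qed.

Theorem theorem1 (R : realType) (V V' : finType)
    (S : simplicial_complex V) (S' : simplicial_complex V')
    (hS : triangulated_surface R S) (hS' : triangulated_surface R S')
    (f : {t : {set V} | t \in triangles S} ->
         {t : {set V'} | t \in triangles S'})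
    (hf : bijective f)
    (hI : forall t1 t2 : {t : {set V} | t \in triangles S},
        #|(val t1 :&: val t2)%SET| = #|(val (f t1) :&: val (f t2))%SET|) :
  isomorphic S S'.
Proof.
apply: (same_triangulation_isomorphic hS hS').
pose m t t' := exists2 x, val x = t & val (f x) = t'.
apply: (intersection_matrix_determines (m := m) (surface_combinatorial hS)
    (surface_combinatorial hS')).
split.
- by move=> _ _ [x <- _]; exact: valP.
- by move=> _ _ [x _ <-]; exact: valP.
- by move=> t tT; exists (val (f (exist _ t tT))), (exist _ t tT).
- have [g fK gK] := hf => t tT.
  by exists (val (g (exist _ t tT))), (g (exist _ t tT)); rewrite ?gK.
- by move=> _ _ _ _ [x <- <-] [y <- <-].
Qed.
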